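(* Let $\mathscr{F}$ be a weakly idempotent complete Frobenius exact category and let $u\colon I\to J$ be a functor between finite direct categories. Then there is an exact functor $$u_!\colon\mathrm{GProj}(\mathscr{F}^I)\to\mathrm{GProj}(\mathscr{F}^J)$$ and an isomorphism $$\mathrm{Hom}_{\mathscr{F}^I}(G,u^*(Y))\cong\mathrm{Hom}_{\mathscr{F}^J}(u_!(G),Y)$$ natural in both variables, where $G\in\mathrm{GProj}(\mathscr{F}^I)$ and $Y\in\mathscr{F}^J$.
   Context: An exact category is weakly idempotent complete if every section has a cokernel (equivalently every retraction has a kernel); it is Frobenius if it has enough projectives and enough injectives and these classes coincide. A finite category $I$ (finitely many objects and morphisms) is finite direct if there are an integer $n\ge0$ and $d\colon\mathrm{Ob}(I)\to\{0,\dots,n\}$ with $d(i)<d(j)$ for every non-identity morphism $i\to j$. $\mathscr{F}^I$ is the category of functors $I\to\mathscr{F}$ with the termwise exact structure, and $u^*\colon\mathscr{F}^J\to\mathscr{F}^I$, $Y\mapsto Y\circ u$, is restriction. $\mathrm{GProj}(\mathscr{F}^I)$ is the full subcategory of $X\in\mathscr{F}^I$ with $\mathrm{Ext}^m_{\mathscr{F}^I}(X,P)=0$ for all projective $P\in\mathscr{F}^I$ and all $m>0$; it is closed under extensions and carries the exact structure inherited from $\mathscr{F}^I$. *)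

(* Defs.v *)
From HB Require Import structures.
From Stdlib Require Import Relations.
From mathcomp Require Import all_boot all_order all_algebra.
From mathcomp Require Import all_classical.

Set Implicit Arguments.
Unset Strict Implicit.
Unset Printing Implicit Defensive.

Import GRing.Theory.
Local Open Scope ring_scope.

Declare Scope cat_scope.
Delimit Scope cat_scope with cat.
Local Open Scope cat_scope.

(** * Categories, functors, natural transformations *)

Record category := Category {
  ob :> Type;
  mor : ob -> ob -> Type;
  idm : forall X, mor X X;
  compm : forall X Y Z, mor Y Z -> mor X Y -> mor X Z;
  comp1m : forall X Y (f : mor X Y), compm (idm Y) f = f;
  compm1 : forall X Y (f : mor X Y), compm f (idm X) = f;
  compmA : forall X Y Z T (h : mor Z T) (g : mor Y Z) (f : mor X Y),
    compm h (compm g f) = compm (compm h g) f }.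

Arguments mor {c} X Y.
Arguments idm {c} X.
Arguments compm {c X Y Z} g f.

Notation "g ∘ f" := (compm g f) (at level 40, left associativity) : cat_scope.

Record functor (C D : category) := Functor {
  fob :> C -> D;
  fmor : forall X Y : C, mor X Y -> mor (fob X) (fob Y);
  fmor1 : forall X : C, fmor (idm X) = idm (fob X);
  fmorM : forall (X Y Z : C) (g : mor Y Z) (f : mor X Y),
    fmor (g ∘ f) = fmor g ∘ fmor f }.

Arguments fmor {C D} _ {X Y} _.

Record nattrans (C D : category) (S T : functor C D) := NatTrans {
  napp :> forall X : C, mor (S X) (T X);
  naturality : forall (X Y : C) (f : mor X Y),
    napp Y ∘ fmor S f = fmor T f ∘ napp X }.

Lemma nattransP (C D : category) (S T : functor C D) (a b : nattrans S T) :
  (forall X, a X = b X) -> a = b.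
Proof.
case: a b => [a na] [b nb] /= eqab.
have {}eqab : a = b by exact: functional_extensionality_dep.
by subst b; congr NatTrans; exact: Prop_irrelevance.
Qed.

(** * Preadditive and additive categories *)

Record preadditive := Preadditive {
  pcat :> category;
  homZ : forall X Y : pcat, GRing.Zmodule (mor X Y);
  compDl_ax : forall (X Y Z : pcat) (g g' : mor Y Z) (f : mor X Y),
    let add {A B : pcat} := @GRing.add (GRing.Zmodule.Pack (homZ A B)) in
    add (g : mor Y Z) g' ∘ f = add (g ∘ f) (g' ∘ f);
  compDr_ax : forall (X Y Z : pcat) (g : mor Y Z) (f f' : mor X Y),
    let add {A B : pcat} := @GRing.add (GRing.Zmodule.Pack (homZ A B)) in
    g ∘ add (f : mor X Y) f' = add (g ∘ f) (g ∘ f') }.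

HB.instance Definition _ (C : preadditive) (X Y : C) :
  GRing.Zmodule (mor X Y) := homZ X Y.

Lemma compDl (C : preadditive) (X Y Z : C) (g g' : mor Y Z) (f : mor X Y) :
  (g + g') ∘ f = g ∘ f + g' ∘ f.
Proof. exact: compDl_ax. Qed.

Lemma compDr (C : preadditive) (X Y Z : C) (g : mor Y Z) (f f' : mor X Y) :
  g ∘ (f + f') = g ∘ f + g ∘ f'.
Proof. exact: compDr_ax. Qed.

Lemma comp0m (C : preadditive) (X Y Z : C) (f : mor X Y) :
  (0 : mor Y Z) ∘ f = 0.
Proof. by apply: (addrI ((0 : mor Y Z) ∘ f)); rewrite -compDl !addr0. Qed.

Lemma compm0 (C : preadditive) (X Y Z : C) (g : mor Y Z) :
  g ∘ (0 : mor X Y) = 0.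
Proof. by apply: (addrI (g ∘ (0 : mor X Y))); rewrite -compDr !addr0. Qed.

Lemma compNm (C : preadditive) (X Y Z : C) (g : mor Y Z) (f : mor X Y) :
  (- g) ∘ f = - (g ∘ f).
Proof. by apply: (addrI (g ∘ f)); rewrite -compDl !subrr comp0m. Qed.

Lemma compmN (C : preadditive) (X Y Z : C) (g : mor Y Z) (f : mor X Y) :
  g ∘ (- f) = - (g ∘ f).
Proof. by apply: (addrI (g ∘ f)); rewrite -compDr !subrr compm0. Qed.

Section Preadditive.
Variable C : preadditive.
Implicit Types X Y Z T : C.

Definition has_zero_object := exists Z : C, idm Z = 0.

Definition is_biproduct X Y S
    (iX : mor X S) (iY : mor Y S) (pX : mor S X) (pY : mor S Y) :=
  [/\ pX ∘ iX = idm X, pY ∘ iY = idm Y, pX ∘ iY = 0, pY ∘ iX = 0 &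
      iX ∘ pX + iY ∘ pY = idm S].

Definition is_additive :=
  has_zero_object /\
  forall X Y, exists S iX iY pX pY, @is_biproduct X Y S iX iY pX pY.

Definition is_kernel X Y Z (i : mor X Y) (p : mor Y Z) :=
  p ∘ i = 0 /\
  forall T (t : mor T Y), p ∘ t = 0 -> exists! s : mor T X, i ∘ s = t.

Definition is_cokernel X Y Z (i : mor X Y) (p : mor Y Z) :=
  p ∘ i = 0 /\
  forall T (t : mor Y T), t ∘ i = 0 -> exists! s : mor Z T, s ∘ p = t.

Definition is_iso X Y (f : mor X Y) :=
  exists g : mor Y X, g ∘ f = idm X /\ f ∘ g = idm Y.

(* The square  b ∘ i = i' ∘ a  is cocartesian. *)
Definition is_pushout X Y X' Y' (i : mor X Y) (a : mor X X')
    (i' : mor X' Y') (b : mor Y Y') :=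
  b ∘ i = i' ∘ a /\
  forall T (s : mor Y T) (t : mor X' T), s ∘ i = t ∘ a ->
    exists! r : mor Y' T, r ∘ b = s /\ r ∘ i' = t.

(* The square  p ∘ b = c ∘ p'  is cartesian. *)
Definition is_pullback Y Z Y' Z' (p : mor Y Z) (c : mor Z' Z)
    (p' : mor Y' Z') (b : mor Y' Y) :=
  p ∘ b = c ∘ p' /\
  forall T (s : mor T Y) (t : mor T Z'), p ∘ s = c ∘ t ->
    exists! r : mor T Y', b ∘ r = s /\ p' ∘ r = t.

Definition is_section X Y (s : mor X Y) := exists r : mor Y X, r ∘ s = idm X.

Definition weakly_idempotent_complete :=
  forall X Y (s : mor X Y), is_section s ->
  exists (Z : C) (p : mor Y Z), is_cokernel s p.

End Preadditive.

Definition is_additive_functor (C D : preadditive) (T : functor C D) :=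
  forall (X Y : C) (f g : mor X Y), fmor T (f + g) = fmor T f + fmor T g.

(** * Exact categories *)

(* A preadditive category with a distinguished class of composable pairs; the
   axioms of an exact category are the predicate [is_exact] below. *)
Record confcat := ConfCat {
  cpre :> preadditive;
  conflation : forall X Y Z : cpre, mor X Y -> mor Y Z -> Prop }.

Arguments conflation {c X Y Z} i p.

Section Exact.
Variable E : confcat.
Implicit Types X Y Z : E.

Definition admissible_mono X Y (i : mor X Y) :=
  exists (Z : E) (p : mor Y Z), conflation i p.

Definition admissible_epi Y Z (p : mor Y Z) :=
  exists (X : E) (i : mor X Y), conflation i p.

(* Quillen's axioms, in the self-dual presentation
   [E0], [E0^op], [E1], [E1^op], [E2], [E2^op] of Bühler. *)
Record is_exact : Prop := IsExact {
  exact_additive : is_additive E;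
  exact_kerP : forall X Y Z (i : mor X Y) (p : mor Y Z),
    conflation i p -> is_kernel i p /\ is_cokernel i p;
  exact_iso : forall X Y Z X' Y' Z'
      (i : mor X Y) (p : mor Y Z) (i' : mor X' Y') (p' : mor Y' Z')
      (a : mor X X') (b : mor Y Y') (c : mor Z Z'),
    is_iso a -> is_iso b -> is_iso c ->
    b ∘ i = i' ∘ a -> c ∘ p = p' ∘ b ->
    conflation i p -> conflation i' p';
  exact_mono1 : forall X, admissible_mono (idm X);
  exact_epi1 : forall X, admissible_epi (idm X);
  exact_monoM : forall X Y Z (j : mor Y Z) (i : mor X Y),
    admissible_mono i -> admissible_mono j -> admissible_mono (j ∘ i);
  exact_epiM : forall X Y Z (q : mor Y Z) (p : mor X Y),
    admissible_epi p -> admissible_epi q -> admissible_epi (q ∘ p);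
  exact_pushout : forall X Y X' (i : mor X Y) (a : mor X X'),
    admissible_mono i ->
    exists (Y' : E) (i' : mor X' Y') (b : mor Y Y'),
      is_pushout i a i' b /\ admissible_mono i';
  exact_pullback : forall Y Z Z' (p : mor Y Z) (c : mor Z' Z),
    admissible_epi p ->
    exists (Y' : E) (p' : mor Y' Z') (b : mor Y' Y),
      is_pullback p c p' b /\ admissible_epi p' }.

Definition projective P :=
  forall Y Z (p : mor Y Z), admissible_epi p ->
  forall f : mor P Z, exists g : mor P Y, p ∘ g = f.

Definition injective_ob Q :=
  forall X Y (i : mor X Y), admissible_mono i ->
  forall f : mor X Q, exists g : mor Y Q, g ∘ i = f.

Definition enough_projectives :=
  forall X, exists (P : E) (p : mor P X), projective P /\ admissible_epi p.

Definition enough_injectives :=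
  forall X, exists (Q : E) (i : mor X Q), injective_ob Q /\ admissible_mono i.

Definition is_frobenius :=
  [/\ is_exact, enough_projectives, enough_injectives &
      forall X, projective X <-> injective_ob X].

(** ** Yoneda Ext *)

Record ses X Y := Ses {
  mid : E;
  sinc : mor Y mid;
  spro : mor mid X;
  sconf : conflation sinc spro }.

(* [yext m X Y]: an exact sequence Y -> E_m -> ... -> E_1 -> X given as the
   conflations it is spliced from, K -> E_1 -> X being the first one.  In
   degree 0 an extension is a morphism X -> Y. *)
Fixpoint yext (m : nat) X Y : Type :=
  match m with
  | 0 => mor X Y
  | m'.+1 => match m' with
    | 0 => ses X Y
    | _.+1 => {K : E & (ses X K * yext m' K Y)%type}
    end
  end.

Definition ses_mor X Y X' Y' (s : ses X Y) (s' : ses X' Y')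
    (f : mor X X') (g : mor Y Y') :=
  exists e : mor (mid s) (mid s'),
    e ∘ sinc s = sinc s' ∘ g /\ spro s' ∘ e = f ∘ spro s.

(* There is a map of exact sequences with end components f and g. *)
Fixpoint yext_mor (m : nat) X Y X' Y' :
    yext m X Y -> yext m X' Y' -> mor X X' -> mor Y Y' -> Prop :=
  match m with
  | 0 => fun s s' f g => g ∘ s = s' ∘ f
  | m'.+1 =>
    match m' as k return
      (forall A B A' B', yext k A B -> yext k A' B' ->
         mor A A' -> mor B B' -> Prop) ->
      yext k.+1 X Y -> yext k.+1 X' Y' -> mor X X' -> mor Y Y' -> Prop
    with
    | 0 => fun _ s s' f g => ses_mor s s' f g
    | _.+1 => fun rec s s' f g =>
        exists k : mor (projT1 s) (projT1 s'),
          ses_mor (projT2 s).1 (projT2 s').1 f k /\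
          rec _ _ _ _ (projT2 s).2 (projT2 s').2 k g
    end (@yext_mor m')
  end.

Definition yext_equiv m X Y : yext m X Y -> yext m X Y -> Prop :=
  clos_refl_sym_trans _ (fun s s' => yext_mor s s' (idm X) (idm Y)).

(* The set of equivalence classes of m-extensions. *)
Definition Ext m X Y :=
  {c : yext m X Y -> Prop | exists s, c = yext_equiv s}.

(* The abelian group Ext^m(X, Y) vanishes iff it has no two distinct elements;
   the Baer sum is not needed to say this. *)
Definition Ext_vanishes m X Y := forall a b : Ext m X Y, a = b.

Definition gorenstein_projective X :=
  forall P, projective P -> forall m, (0 < m)%N -> Ext_vanishes m X P.

End Exact.

Definition is_exact_functor (E E' : confcat) (T : functor E E') :=
  is_additive_functor T /\
  forall (X Y Z : E) (i : mor X Y) (p : mor Y Z),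
    conflation i p -> conflation (fmor T i) (fmor T p).

(** * Full subcategories *)

Section Full.
Variables (E : confcat) (P : E -> Prop).

Definition full_category : category :=
  @Category {X : E | P X} (fun X Y => mor (sval X) (sval Y))
    (fun X => idm (sval X)) (fun X Y Z g f => g ∘ f)
    (fun X Y f => comp1m f) (fun X Y f => compm1 f)
    (fun X Y Z T h g f => compmA h g f).

Definition full_preadditive : preadditive :=
  @Preadditive full_category (fun X Y => homZ (sval X) (sval Y))
    (fun X Y Z g g' f => compDl_ax g g' f)
    (fun X Y Z g f f' => compDr_ax g f f').

Definition full_confcat : confcat :=
  @ConfCat full_preadditive
    (fun X Y Z (i : mor (sval X) (sval Y)) (p : mor (sval Y) (sval Z)) =>
       conflation i p).

End Full.

(** * Functor categories *)

Section FunctorCategory.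
Variables (I : category) (E : confcat).
Implicit Types X Y Z T : functor I E.

Program Definition nat_id X : nattrans X X :=
  @NatTrans _ _ X X (fun i => idm (X i)) _.
Next Obligation. by move=> X i j f; rewrite comp1m compm1. Qed.

Program Definition nat_comp X Y Z (b : nattrans Y Z) (a : nattrans X Y) :
    nattrans X Z :=
  @NatTrans _ _ X Z (fun i => b i ∘ a i) _.
Next Obligation.
by move=> X Y Z b a i j f; rewrite -compmA naturality compmA naturality compmA.
Qed.

Program Definition functor_category : category :=
  @Category (functor I E) (@nattrans I E) nat_id nat_comp _ _ _.
Next Obligation. by move=> X Y a; apply: nattransP => i; exact: comp1m. Qed.
Next Obligation. by move=> X Y a; apply: nattransP => i; exact: compm1. Qed.
Next Obligation.
by move=> X Y Z T c b a; apply: nattransP => i; exact: compmA.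
Qed.

Program Definition nat_zero X Y : nattrans X Y :=
  @NatTrans _ _ X Y (fun i => 0) _.
Next Obligation. by move=> X Y i j f; rewrite comp0m compm0. Qed.

Program Definition nat_opp X Y (a : nattrans X Y) : nattrans X Y :=
  @NatTrans _ _ X Y (fun i => - a i) _.
Next Obligation.
by move=> X Y a i j f; rewrite compNm compmN naturality.
Qed.

Program Definition nat_add X Y (a b : nattrans X Y) : nattrans X Y :=
  @NatTrans _ _ X Y (fun i => a i + b i) _.
Next Obligation.
by move=> X Y a b i j f; rewrite compDl compDr !naturality.
Qed.

HB.instance Definition _ X Y := gen_eqMixin (nattrans X Y).
HB.instance Definition _ X Y := gen_choiceMixin (nattrans X Y).

Lemma nat_addA X Y : associative (@nat_add X Y).
Proof. by move=> a b c; apply: nattransP => i; exact: addrA. Qed.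
Lemma nat_addC X Y : commutative (@nat_add X Y).
Proof. by move=> a b; apply: nattransP => i; exact: addrC. Qed.
Lemma nat_add0 X Y : left_id (nat_zero X Y) (@nat_add X Y).
Proof. by move=> a; apply: nattransP => i; exact: add0r. Qed.
Lemma nat_addN X Y : left_inverse (nat_zero X Y) (@nat_opp X Y) (@nat_add X Y).
Proof. by move=> a; apply: nattransP => i; exact: addNr. Qed.

HB.instance Definition _ X Y := GRing.isZmodule.Build (nattrans X Y)
  (@nat_addA X Y) (@nat_addC X Y) (@nat_add0 X Y) (@nat_addN X Y).

Program Definition functor_preadditive : preadditive :=
  @Preadditive functor_category
    (fun X Y => GRing.Zmodule.on (nattrans X Y)) _ _.
Next Obligation.
by move=> X Y Z b b' a; apply: nattransP => i; exact: compDl.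
Qed.
Next Obligation.
by move=> X Y Z b a a'; apply: nattransP => i; exact: compDr.
Qed.

Definition functor_confcat : confcat :=
  @ConfCat functor_preadditive
    (fun X Y Z (a : nattrans X Y) (b : nattrans Y Z) =>
       forall i : I, conflation (a i) (b i)).

End FunctorCategory.

Definition GProj (E : confcat) : confcat :=
  full_confcat (@gorenstein_projective E).

(** * Restriction along a functor *)

Section Restriction.
Variables (I J : category) (u : functor I J) (E : confcat).

Program Definition restr_ob (Y : functor J E) : functor I E :=
  @Functor I E (fun i => Y (u i)) (fun i j f => fmor Y (fmor u f)) _ _.
Next Obligation. by move=> Y i /=; rewrite !fmor1. Qed.
Next Obligation. by move=> Y i j k g f /=; rewrite !fmorM. Qed.

Program Definition restr_map (Y Z : functor J E) (a : nattrans Y Z) :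
    nattrans (restr_ob Y) (restr_ob Z) :=
  @NatTrans _ _ (restr_ob Y) (restr_ob Z) (fun i => a (u i)) _.
Next Obligation. by move=> Y Z a i j f; exact: (naturality a (fmor u f)). Qed.

Program Definition restriction :
    functor (functor_confcat J E) (functor_confcat I E) :=
  @Functor (functor_confcat J E) (functor_confcat I E) restr_ob restr_map _ _.
Next Obligation. by move=> Y; apply: nattransP. Qed.
Next Obligation. by move=> X Y Z b a; apply: nattransP. Qed.

End Restriction.

(** * Finite direct categories *)

Definition finite_category (I : category) :=
  finite_set [set: I]%classic /\
  forall i j : I, finite_set [set: mor i j]%classic.

Variant is_identity (I : category) (i : I) : forall j : I, mor i j -> Prop :=
  IsIdentity : is_identity (idm i).

Definition finite_direct (I : category) :=
  finite_category I /\
  exists (n : nat) (d : I -> 'I_n.+1),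
    forall (i j : I) (f : mor i j), ~ is_identity f -> (d i < d j)%N.

(* Main.v *)
(* Call W termwise projective if all its values are projective, hence
   injective, objects of F.

   A functor G on I is Gorenstein projective iff Ext^1(G, W) = 0 for all
   termwise projective W.  For "only if", write T(W) for the sum over the objects
   i of I of the functors freely generated at i by W(i), and K(W) for the kernel
   of T(W) -> W; T(W) is projective, K(W) is termwise projective, and K(W)
   starts one degree higher than W because I is direct, so W has a finite
   resolution by projectives.  For "if", the class of all G with Ext^1(G, W) = 0
   for all termwise projective W is closed under kernels of admissible
   epimorphisms, by embedding W into the product of the functors cofreely
   generated by its values.

   u_! is built along the finite resolution of G by the objects T.  It sends a
   functor freely generated at i to one freely generated at u(i), and if u_! K
   and u_! T exist then u_! G is the cokernel of u_! K -> u_! T.  That this map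
   is a termwise admissible monomorphism, and likewise the exactness of u_!, is
   tested by mapping into injective objects Q of F: maps from the value at j into
   Q correspond to maps into a termwise projective functor W coinduced from Q, so
   by adjunction the test becomes the exactness of Hom(-, u^* W), that is, the
   vanishing of Ext^1(G, u^* W).  Weak idempotent completeness makes such a test
   conclusive. *)

From HB Require Import structures.
Require Import Defs.
From Stdlib Require Import Relations.
From Stdlib Require List.
From mathcomp Require Import all_boot all_algebra all_classical.

Set Implicit Arguments.
Unset Strict Implicit.
Unset Printing Implicit Defensive.

Import GRing.Theory.
Local Open Scope ring_scope.
Local Open Scope cat_scope.

(** * Preadditive and opposite categories *)

Section PreadditiveTheory.
Variable C : preadditive.
Implicit Types X Y Z T : C.

Lemma compBl X Y Z (g g' : mor Y Z) (f : mor X Y) :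
  (g - g') ∘ f = g ∘ f - g' ∘ f.
Proof. by rewrite compDl compNm. Qed.

Lemma compBr X Y Z (g : mor Y Z) (f f' : mor X Y) :
  g ∘ (f - f') = g ∘ f - g ∘ f'.
Proof. by rewrite compDr compmN. Qed.

Lemma kernel_comp0 X Y Z (i : mor X Y) (p : mor Y Z) :
  is_kernel i p -> p ∘ i = 0.
Proof. by case. Qed.

Lemma kernel_mono X Y Z T (i : mor X Y) (p : mor Y Z) (f g : mor T X) :
  is_kernel i p -> i ∘ f = i ∘ g -> f = g.
Proof.
case=> pi0 ker eq_if.
have [|s [_ uniq_s]] := ker T (i ∘ g); first by rewrite compmA pi0 comp0m.
by rewrite -(uniq_s f eq_if) -(uniq_s g erefl).
Qed.

Lemma kernel_lift X Y Z T (i : mor X Y) (p : mor Y Z) (t : mor T Y) :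
  is_kernel i p -> p ∘ t = 0 -> exists s : mor T X, i ∘ s = t.
Proof. by case=> _ ker /ker[s [eq_s _]]; exists s. Qed.

Lemma is_kernelP X Y Z (i : mor X Y) (p : mor Y Z) :
    p ∘ i = 0 -> (forall T (f g : mor T X), i ∘ f = i ∘ g -> f = g) ->
    (forall T (t : mor T Y), p ∘ t = 0 -> exists s : mor T X, i ∘ s = t) ->
  is_kernel i p.
Proof.
move=> pi0 mono lift; split=> // T t /lift[s eq_s]; exists s; split=> // s' eq'.
by apply: mono; rewrite eq_s.
Qed.

Lemma cokernel_comp0 X Y Z (i : mor X Y) (p : mor Y Z) :
  is_cokernel i p -> p ∘ i = 0.
Proof. by case. Qed.

Lemma cokernel_epi X Y Z T (i : mor X Y) (p : mor Y Z) (f g : mor Z T) :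
  is_cokernel i p -> f ∘ p = g ∘ p -> f = g.
Proof.
case=> pi0 coker eq_fp.
have [|s [_ uniq_s]] := coker T (g ∘ p); first by rewrite -compmA pi0 compm0.
by rewrite -(uniq_s f eq_fp) -(uniq_s g erefl).
Qed.

Lemma cokernel_desc X Y Z T (i : mor X Y) (p : mor Y Z) (t : mor Y T) :
  is_cokernel i p -> t ∘ i = 0 -> exists s : mor Z T, s ∘ p = t.
Proof. by case=> _ coker /coker[s [eq_s _]]; exists s. Qed.

Lemma is_cokernelP X Y Z (i : mor X Y) (p : mor Y Z) :
    p ∘ i = 0 -> (forall T (f g : mor Z T), f ∘ p = g ∘ p -> f = g) ->
    (forall T (t : mor Y T), t ∘ i = 0 -> exists s : mor Z T, s ∘ p = t) ->
  is_cokernel i p.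
Proof.
move=> pi0 epi desc; split=> // T t /desc[s eq_s]; exists s; split=> // s' eq'.
by apply: epi; rewrite eq_s.
Qed.

Lemma pushout_square X Y X' Y' (i : mor X Y) (a : mor X X')
    (i' : mor X' Y') (b : mor Y Y') :
  is_pushout i a i' b -> b ∘ i = i' ∘ a.
Proof. by case. Qed.

Lemma pushout_desc X Y X' Y' (i : mor X Y) (a : mor X X')
    (i' : mor X' Y') (b : mor Y Y') T (s : mor Y T) (t : mor X' T) :
  is_pushout i a i' b -> s ∘ i = t ∘ a ->
  exists r : mor Y' T, r ∘ b = s /\ r ∘ i' = t.
Proof. by case=> _ po /po[r [eq_r _]]; exists r. Qed.

Lemma pushout_epi X Y X' Y' (i : mor X Y) (a : mor X X')
    (i' : mor X' Y') (b : mor Y Y') T (f g : mor Y' T) :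
  is_pushout i a i' b -> f ∘ b = g ∘ b -> f ∘ i' = g ∘ i' -> f = g.
Proof.
case=> sq po eq_b eq_i.
have [|r [_ uniq_r]] := po T (g ∘ b) (g ∘ i').
  by rewrite -!compmA sq.
by rewrite -(uniq_r f (conj eq_b eq_i)) -(uniq_r g (conj erefl erefl)).
Qed.

Lemma is_iso_id X : is_iso (idm X).
Proof. by exists (idm X); rewrite comp1m. Qed.

Lemma zero_mor_l X Y (f : mor X Y) : idm X = 0 -> f = 0.
Proof. by move=> X0; rewrite -[f]compm1 X0 compm0. Qed.

Lemma zero_mor_r X Y (f : mor X Y) : idm Y = 0 -> f = 0.
Proof. by move=> Y0; rewrite -[f]comp1m Y0 comp0m. Qed.

(** This is the transport of the biproduct along the automorphism [idm S + iY ∘ g ∘ pX] of [S]. *)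
Lemma biproduct_shear X Y S (iX : mor X S) (iY : mor Y S) (pX : mor S X)
    (pY : mor S Y) (g : mor X Y) :
  is_biproduct iX iY pX pY ->
  is_biproduct (iX + iY ∘ g) iY pX (pY - g ∘ pX).
Proof.
case=> pXiX pYiY pXiY pYiX sum; split=> //.
- by rewrite compDr compmA pXiX pXiY comp0m addr0.
- by rewrite compBl -compmA pXiY compm0 subr0.
- rewrite compBl !compDr !compmA pYiX pYiY -!compmA pXiX (compmA pX) pXiY.
  by rewrite comp0m compm0 addr0 compm1 comp1m add0r subrr.
- by rewrite compDl compBr -!compmA addrACA subrr addr0.
Qed.

Lemma biproduct_swap X Y S (iX : mor X S) (iY : mor Y S) (pX : mor S X)
    (pY : mor S Y) :
  is_biproduct iX iY pX pY -> is_biproduct iY iX pY pX.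
Proof. by case=> *; split=> //; rewrite addrC. Qed.

Lemma biproduct_ext_l X Y S T (iX : mor X S) (iY : mor Y S) (pX : mor S X)
    (pY : mor S Y) (f g : mor S T) :
  is_biproduct iX iY pX pY -> f ∘ iX = g ∘ iX -> f ∘ iY = g ∘ iY -> f = g.
Proof.
case=> _ _ _ _ sum eqX eqY.
by rewrite -[f]compm1 -[g]compm1 -sum !compDr !compmA eqX eqY.
Qed.

End PreadditiveTheory.

(** * Opposite categories and duality *)

Section Opposite.

(** Only the order of arguments changes, so a kernel, a pullback or an admissible epimorphism is by
    conversion a cokernel, a pushout or an admissible monomorphism of the opposite. Dual lemmas are
    then mere instances. *)
Definition op_category (C : category) : category :=
  @Category C (fun X Y => mor Y X) (fun X => idm X) (fun X Y Z g f => f ∘ g)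
    (fun X Y f => compm1 f) (fun X Y f => comp1m f)
    (fun X Y Z T h g f => esym (compmA f g h)).

Definition op_preadditive (C : preadditive) : preadditive :=
  @Preadditive (op_category C) (fun X Y => homZ Y X)
    (fun X Y Z g g' f => compDr_ax f g g')
    (fun X Y Z g f f' => compDl_ax f f' g).

Definition op_confcat (E : confcat) : confcat :=
  @ConfCat (op_preadditive E)
    (fun X Y Z (i : @mor E Y X) (p : @mor E Z Y) => conflation p i).

Lemma is_additive_op (C : preadditive) :
  is_additive C -> is_additive (op_preadditive C).
Proof.
move=> [[Z Z0] bip]; split; first by exists Z.
move=> X Y; have [S [iX [iY [pX [pY [h1 h2 h3 h4 h5]]]]]] := bip X Y.
by exists S, pX, pY, iX, iY; split.
Qed.

Lemma iso_square (C : category) (X Y X' Y' : C) (p : mor X Y) (p' : mor X' Y')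
    (c : mor X' X) (c' : mor X X') (b : mor Y' Y) (b' : mor Y Y') :
  c ∘ c' = idm X -> b' ∘ b = idm Y' -> p ∘ c = b ∘ p' -> b' ∘ p = p' ∘ c'.
Proof.
move=> cc' b'b sq.
by rewrite -[b' ∘ p]compm1 -cc' !compmA -(compmA b') sq !compmA b'b comp1m.
Qed.

Lemma is_exact_op (E : confcat) : is_exact E -> is_exact (op_confcat E).
Proof.
move=> exE; split.
- exact: (is_additive_op (exact_additive exE)).
- by move=> X Y Z i p /(exact_kerP exE)[].
- move=> X Y Z X' Y' Z' i p i' p' a b c [a' [a'a aa']] [b' [b'b bb']].
  move=> [c' [c'c cc']] /= bi cp conf.
  apply: (@exact_iso _ exE _ _ _ _ _ _ _ _ _ _ c' b' a') conf.
  + by exists c.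
  + by exists b.
  + by exists a.
  + exact: (@iso_square E _ _ _ _ _ _ _ _ _ _ c'c bb' cp).
  + exact: (@iso_square E _ _ _ _ _ _ _ _ _ _ b'b aa' bi).
- by move=> X; exact: (exact_epi1 exE X).
- by move=> X; exact: (exact_mono1 exE X).
- by move=> X Y Z j i mi mj; exact: (exact_epiM exE mj mi).
- by move=> X Y Z q p mp mq; exact: (exact_monoM exE mq mp).
- by move=> X Y X' i a mi; exact: (exact_pullback exE a mi).
- by move=> Y Z Z' p c mp; exact: (exact_pushout exE c mp).
Qed.

(** The idempotent [idm Y - s ∘ r] kills [s], hence descends to a map [t] out of the cokernel, and
    this map splits [p]. *)
Lemma retraction_kernel (C : preadditive) (X Y : C)
    (s : mor X Y) (r : mor Y X) :
  weakly_idempotent_complete C -> r ∘ s = idm X ->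
  exists (Z : C) (t : mor Z Y) (p : mor Y Z),
    [/\ p ∘ t = idm Z, p ∘ s = 0, r ∘ t = 0 & s ∘ r + t ∘ p = idm Y].
Proof.
move=> wic rs; have [|Z [p cok]] := wic _ _ s; first by exists r.
have [|t tp] := cokernel_desc (t := idm Y - s ∘ r) cok.
  by rewrite compBl -compmA rs comp1m compm1 subrr.
have ps := cokernel_comp0 cok.
have eqid : s ∘ r + t ∘ p = idm Y by rewrite tp addrC subrK.
exists Z, t, p; split=> //; apply: (cokernel_epi cok).
  by rewrite -compmA tp compBr compmA ps comp0m subr0 compm1 comp1m.
by rewrite -compmA tp compBr compmA rs compm1 comp1m subrr comp0m.
Qed.

(** A splitting is symmetric in its two summands, so the inclusion [t] of the complement is a kernel
    of the retraction. *)
Lemma wic_op (C : preadditive) :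
  weakly_idempotent_complete C -> weakly_idempotent_complete (op_preadditive C).
Proof.
move=> wic X Y r [s rs].
have [Z [t [p [pt ps rt eqid]]]] := retraction_kernel wic rs.
exists Z, t; apply: is_cokernelP => //.
  move=> T f g tf; change (@compm C T Z Y t f = @compm C T Z Y t g) in tf.
  change (@mor C T Z) in f; change (@mor C T Z) in g.
  by rewrite -[f](@comp1m C) -[g](@comp1m C) -pt -!(@compmA C) tf.
move=> T x rx; change (@compm C T Y X r x = 0) in rx.
change (@mor C T Y) in x; exists (@compm C T Y Z p x).
change (@compm C T Z Y t (@compm C T Y Z p x) = x).
rewrite compmA -[RHS](@comp1m C) -eqid compDl -(@compmA C _ _ _ _ s) rx.
by rewrite compm0 add0r.
Qed.

End Opposite.

(** * Exact categories *)

Section ExactTheory.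
Variable E : confcat.
Hypothesis exE : is_exact E.
Implicit Types X Y Z T : E.

Lemma conf_kernel X Y Z (i : mor X Y) (p : mor Y Z) :
  conflation i p -> is_kernel i p.
Proof. by move=> /(exact_kerP exE)[]. Qed.

Lemma conf_cokernel X Y Z (i : mor X Y) (p : mor Y Z) :
  conflation i p -> is_cokernel i p.
Proof. by move=> /(exact_kerP exE)[]. Qed.

(** Cokernels are unique up to isomorphism, and conflations are closed under isomorphism. *)
Lemma conf_of_cokernel X Y Z (i : mor X Y) (p : mor Y Z) :
  admissible_mono i -> is_cokernel i p -> conflation i p.
Proof.
case=> Z' [p' conf] cok; have cok' := conf_cokernel conf.
have [c cp'] := cokernel_desc cok' (cokernel_comp0 cok).
have [c' c'p] := cokernel_desc cok (cokernel_comp0 cok').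
apply: (@exact_iso _ exE _ _ _ _ _ _ _ _ _ _ (idm X) (idm Y) c) conf.
- exact: is_iso_id.
- exact: is_iso_id.
- exists c'; split.
    by apply: (cokernel_epi cok'); rewrite -compmA cp' c'p comp1m.
  by apply: (cokernel_epi cok); rewrite -compmA c'p cp' comp1m.
- by rewrite comp1m compm1.
- by rewrite compm1.
Qed.

Lemma pushout_admissible X Y X' Y' (i : mor X Y) (a : mor X X')
    (i' : mor X' Y') (b : mor Y Y') :
  is_pushout i a i' b -> admissible_mono i -> admissible_mono i'.
Proof.
move=> po mi.
have [Y2 [i2 [b2 [po2 [Z [p conf]]]]]] := exact_pushout exE a mi.
have [r [rb ri]] := pushout_desc po2 (pushout_square po).
have [s [sb si]] := pushout_desc po (pushout_square po2).
have sr : s ∘ r = idm Y2.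
  by apply: (pushout_epi po2); rewrite -compmA ?rb ?ri ?sb ?si comp1m.
exists Z, (p ∘ s).
apply: (@exact_iso _ exE _ _ _ _ _ _ _ _ _ _ (idm X') r (idm Z)) conf.
- exact: is_iso_id.
- exists s; split=> //.
  by apply: (pushout_epi po); rewrite -compmA ?sb ?si ?rb ?ri comp1m.
- exact: is_iso_id.
- by rewrite ri compm1.
- by rewrite -compmA sr comp1m compm1.
Qed.

(** A pushout does not change the cokernel: [q] is induced by [p] and [0]. *)
Lemma conf_pushout X Y Z X' (i : mor X Y) (p : mor Y Z) (a : mor X X') :
  conflation i p ->
  exists (Y' : E) (i' : mor X' Y') (b : mor Y Y') (q : mor Y' Z),
    [/\ is_pushout i a i' b, conflation i' q & q ∘ b = p].
Proof.
move=> conf; have mi : admissible_mono i by exists Z, p.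
have [Y' [i' [b [po mi']]]] := exact_pushout exE a mi.
have cok := conf_cokernel conf.
have [|q [qb qi]] := pushout_desc (s := p) (t := 0 : mor X' Z) po.
  by rewrite comp0m (cokernel_comp0 cok).
exists Y', i', b, q; split=> //; apply: (conf_of_cokernel mi').
apply: is_cokernelP => //.
- by move=> T f g eq_q; apply: (cokernel_epi cok); rewrite -qb !compmA eq_q.
- move=> T t ti0; have [|s sp] := cokernel_desc (t := t ∘ b) cok.
    by rewrite -compmA (pushout_square po) compmA ti0 comp0m.
  exists s; apply: (pushout_epi po); first by rewrite -compmA qb sp.
  by rewrite -compmA qi compm0 ti0.
Qed.

(** Pushing out the conflation ending in [idm Y] along the zero map to [X] gives a conflation with
    ends [X] and [Y], whose middle term is again a biproduct and hence isomorphic to [S]. *)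
Lemma biproduct_conf X Y S (iX : mor X S) (iY : mor Y S) (pX : mor S X)
    (pY : mor S Y) :
  is_biproduct iX iY pX pY -> conflation iX pY.
Proof.
case=> pXiX pYiY pXiY pYiX sum.
have [Z0 [i0 conf0]] := exact_epi1 exE Y.
have i00 : i0 = 0.
  by rewrite -[i0]comp1m (kernel_comp0 (conf_kernel conf0)).
have [P [j [b [q [po conf qb]]]]] := conf_pushout (0 : mor Z0 X) conf0.
have [|r [rb rj]] := pushout_desc (s := 0 : mor Y X) (t := idm X) po.
  by rewrite comp0m compm0.
have qj : q ∘ j = 0 := kernel_comp0 (conf_kernel conf).
apply: (@exact_iso _ exE _ _ _ _ _ _ _ _ _ _
  (idm X) (iX ∘ r + iY ∘ q) (idm Y)) conf.
- exact: is_iso_id.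
- exists (j ∘ pX + b ∘ pY); split.
    suff -> : (j ∘ pX + b ∘ pY) ∘ (iX ∘ r + iY ∘ q) = j ∘ r + b ∘ q.
      apply: (pushout_epi po); rewrite compDl -!compmA ?rb ?qb ?rj ?qj.
        by rewrite compm0 add0r compm1 comp1m.
      by rewrite compm0 addr0 compm1 comp1m.
    rewrite compDl !compDr -!compmA (compmA pX) pXiX (compmA pX) pXiY.
    rewrite (compmA pY) pYiX (compmA pY) pYiY !comp0m !comp1m !compm0.
    by rewrite addr0 add0r.
  rewrite compDl !compDr -!compmA (compmA r) rj (compmA r) rb (compmA q) qj.
  by rewrite (compmA q) qb !comp0m !compm0 !comp1m addr0 add0r.
- exact: is_iso_id.
- by rewrite compDl -!compmA rj qj compm0 addr0.
- by rewrite comp1m compDr !compmA pYiX pYiY comp0m add0r comp1m.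
Qed.

End ExactTheory.

Section ExactDual.
Variable E : confcat.
Hypothesis exE : is_exact E.
Implicit Types X Y Z T : E.
Let exE' := is_exact_op exE.

Lemma conf_of_kernel X Y Z (i : mor X Y) (p : mor Y Z) :
  admissible_epi p -> is_kernel i p -> conflation i p.
Proof.
by move=> ep ker; exact: (@conf_of_cokernel _ exE' Z Y X p i ep ker).
Qed.

Lemma pullback_admissible Y Z Y' Z' (p : mor Y Z) (c : mor Z' Z)
    (p' : mor Y' Z') (b : mor Y' Y) :
  is_pullback p c p' b -> admissible_epi p -> admissible_epi p'.
Proof.
by move=> pb ep; exact: (@pushout_admissible _ exE' Z Y Z' Y' p c p' b pb ep).
Qed.

End ExactDual.

(** * Admissibility in weakly idempotent complete exact categories *)

Section WeaklyIdempotentComplete.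
Variable E : confcat.
Hypothesis exE : is_exact E.
Hypothesis wicE : weakly_idempotent_complete E.
Implicit Types X Y Z T : E.

Lemma split_conf X Y Z (s : mor X Y) (r : mor Y X) (t : mor Z Y) (p : mor Y Z) :
  [/\ p ∘ t = idm Z, p ∘ s = 0, r ∘ t = 0 & s ∘ r + t ∘ p = idm Y] ->
  r ∘ s = idm X -> conflation s p /\ conflation t r.
Proof.
move=> [pt ps rt sum] rs; have bip : is_biproduct s t r p by split.
by split; [exact: (biproduct_conf exE bip)
          |exact: (biproduct_conf exE (biproduct_swap bip))].
Qed.

(* The admissible monomorphism [(f, g f)] of A into B + C is sheared to
   [(f, 0)]; pulling its conflation back along the kernel of the retraction
   onto C gives a conflation starting with f. *)
Lemma admissible_mono_factor (A B C : E) (f : mor A B) (g : mor B C) :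
  admissible_mono (g ∘ f) -> admissible_mono f.
Proof.
move Eh: (g ∘ f) => h mh.
have [_ bip] := exact_additive exE.
have [S [iB [iA [pB [pA bipS]]]]] := bip B A.
have [S' [jB0 [jC [qB [qC0 bipS0]]]]] := bip B C.
have bipS' := biproduct_shear (- g) bipS0.
move EjB: (jB0 + _) bipS' => jB; move: (qC0 - _) => qC bipS'.
have [pBiB pAiA pBiA pAiB sumS] := bipS.
have [qBjB qCjC qBjC qCjB sumS'] := bipS'.
pose m2 := jB ∘ pB + jC ∘ (h ∘ pA).
(* [m2] is the direct sum of the identity of [B] and [h], with respect to the sheared inclusion
   [jB]. As a pushout of [h] it is admissible. *)
have po : is_pushout h iA m2 jC.
  split.
    by rewrite /m2 compDl -!compmA pBiA pAiA compm0 add0r compm1.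
  move=> T s t eq_st; exists (t ∘ iB ∘ qB + s ∘ qC); split; first split.
  - by rewrite compDl -!compmA qBjC qCjC !compm0 add0r compm1.
  - rewrite /m2 compDl !compDr -!compmA (compmA qB) qBjB (compmA qB) qBjC.
    rewrite (compmA qC) qCjB (compmA qC) qCjC !comp0m !comp1m !compm0 addr0.
    by rewrite add0r (compmA s) eq_st -!compmA -compDr sumS compm1.
  - move=> r [rj rm]; rewrite -[r]compm1 -sumS' compDr !compmA rj -rm.
    congr (_ ∘ _ + _); rewrite /m2 -!compmA compDl -!compmA pBiB pAiB.
    by rewrite !compm0 addr0 compm1.
have mm2 : admissible_mono m2 by exact: (pushout_admissible exE po).
have m1 : admissible_mono (iA + iB ∘ f).
  exists B, (pB - f ∘ pA).
  exact: (biproduct_conf exE (biproduct_shear f (biproduct_swap bipS))).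
have := exact_monoM exE m1 mm2.
have -> : m2 ∘ (iA + iB ∘ f) = jB0 ∘ f.
  rewrite /m2 compDl !compDr -!compmA (compmA pB) pBiB pBiA pAiA (compmA pA).
  rewrite pAiB !comp0m !compm0 addr0 add0r comp1m compm1 -EjB compDl -Eh.
  by rewrite compmN compNm -!compmA subrK.
move=> [D [d conf]]; have [qBj qCj qBj' qCj' sum0] := bipS0.
have kerd := conf_kernel exE conf; have cokd := conf_cokernel exE conf.
have [|c cd] := cokernel_desc (t := qC0) cokd.
  by rewrite compmA qCj' comp0m.
pose s := d ∘ jC.
have cs : c ∘ s = idm C by rewrite /s compmA cd qCj.
have [D' [t [w [wt ws ct sumD]]]] := retraction_kernel wicE cs.
have [confsw _] := split_conf (And4 wt ws ct sumD) cs.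
(* [D'] is the kernel of [c] and [c ∘ d = qC0], so its preimage under [d] is the kernel of [qC0],
   that is [B]. *)
have pb : is_pullback d t (w ∘ d ∘ jB0) jB0.
  have tw : t ∘ w = idm D - s ∘ c by rewrite -sumD addrAC subrr add0r.
  split.
    rewrite !compmA tw compBl comp1m -(compmA s) cd compBl -(compmA s) qCj'.
    by rewrite compm0 subr0.
  move=> T x y eqxy; have qCx : qC0 ∘ x = 0.
    by rewrite -cd -compmA eqxy compmA ct comp0m.
  have jx : jB0 ∘ (qB ∘ x) = x.
    by rewrite -[RHS]comp1m -sum0 compDl -!compmA qCx compm0 addr0.
  exists (qB ∘ x); split; first split=> //.
    by rewrite -!compmA jx eqxy compmA wt comp1m.
  by move=> r [<- _]; rewrite compmA qBj comp1m.
have ewd : admissible_epi (w ∘ d ∘ jB0).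
  by apply: (pullback_admissible exE pb); exists A, (jB0 ∘ f).
exists D', (w ∘ d ∘ jB0); apply: (conf_of_kernel exE) => //.
apply: is_kernelP.
- by rewrite -!compmA (kernel_comp0 kerd) compm0.
- by move=> T x y eqf; apply: (kernel_mono kerd); rewrite -!compmA eqf.
- move=> T x wx; have [|y jfy] := kernel_lift (t := jB0 ∘ x) kerd.
    case: pb => sq _; rewrite compmA sq -compmA.
    by rewrite wx compm0.
  by exists y; rewrite -[RHS]comp1m -qBj -compmA -jfy !compmA qBj comp1m.
Qed.

(* Testing against injectives: the first hypothesis makes i admissible, and
   the second then identifies the comparison map coker i -> C, first as an
   admissible monomorphism, then as an isomorphism. *)
Lemma conflation_by_injectives (A B C : E) (i : mor A B) (p : mor B C) :
    enough_injectives E -> p ∘ i = 0 ->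
    (forall Q, injective_ob Q -> forall a : mor A Q, exists b, b ∘ i = a) ->
    (forall Q, injective_ob Q -> forall b : mor B Q, b ∘ i = 0 ->
       exists c, c ∘ p = b) ->
    (forall Q, injective_ob Q -> forall c c' : mor C Q, c ∘ p = c' ∘ p ->
       c = c') ->
  conflation i p.
Proof.
move=> enough pi0 ext desc epi.
have mi : admissible_mono i.
  have [Q [a [injQ ma]]] := enough A; have [b bi] := ext Q injQ a.
  by apply: (admissible_mono_factor (g := b)); rewrite bi.
have [C' [p' conf]] := mi; have cok := conf_cokernel exE conf.
have [k kp'] := cokernel_desc cok pi0.
have [D [q confk]] : admissible_mono k.
  have [Q [a [injQ ma]]] := enough C'.
  have [|c cp] := desc Q injQ (a ∘ p').
    by rewrite -compmA (cokernel_comp0 cok) compm0.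
  apply: (admissible_mono_factor (g := c)); suff -> : c ∘ k = a by [].
  by apply: (cokernel_epi cok); rewrite -compmA kp' cp.
(* Since [q ∘ p] factors through [q ∘ k = 0], the last hypothesis kills the composite of [q] with an
   embedding of [D] into an injective. *)
have q0 : q = 0.
  have [Q [a [injQ [R [r conf']]]]] := enough D.
  apply: (kernel_mono (conf_kernel exE conf')); apply: (epi Q injQ).
  rewrite -kp' compm0 comp0m -!compmA (compmA q).
  by rewrite (kernel_comp0 (conf_kernel exE confk)) comp0m compm0.
have [|k' kk'] := kernel_lift (t := idm C) (conf_kernel exE confk).
  by rewrite q0 comp0m.
have k'k : k' ∘ k = idm C'.
  apply: (kernel_mono (conf_kernel exE confk)).
  by rewrite compmA kk' comp1m compm1.
apply: (@exact_iso _ exE _ _ _ _ _ _ _ _ _ _ (idm A) (idm B) k) conf.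
- exact: is_iso_id.
- exact: is_iso_id.
- by exists k'.
- by rewrite comp1m compm1.
- by rewrite compm1 kp'.
Qed.

End WeaklyIdempotentComplete.

Lemma admissible_epi_factor (E : confcat) (exE : is_exact E)
    (wicE : weakly_idempotent_complete E) (A B C : E)
    (f : mor A B) (g : mor B C) :
  admissible_epi (g ∘ f) -> admissible_epi g.
Proof.
move=> ep; exact: (@admissible_mono_factor (op_confcat E) (is_exact_op exE)
  (wic_op wicE) C B A g f ep).
Qed.

(** * Extensions and syzygies *)

(* The part of the exact structure that the computation of Yoneda extension
   groups by syzygies relies on. *)
Record has_syzygies (E : confcat) : Prop := HasSyzygies {
  syz_kerP : forall (X Y Z : E) (i : mor X Y) (p : mor Y Z),
    conflation i p -> is_kernel i p /\ is_cokernel i p;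
  syz_pushout : forall (X Y Z X' : E) (i : mor X Y) (p : mor Y Z)
      (a : mor X X'),
    conflation i p ->
    exists (Y' : E) (i' : mor X' Y') (b : mor Y Y') (q : mor Y' Z),
      [/\ is_pushout i a i' b, conflation i' q & q ∘ b = p];
  syz_enough : enough_projectives E }.

(* [ext_orth X W] expresses the vanishing of Ext^1(X, W). *)
Definition ext_orth (E : confcat) (X W : E) :=
  forall (A B : E) (i : mor A B) (p : mor B X), conflation i p ->
  forall f : mor A W, exists g : mor B W, g ∘ i = f.

Section Orthogonality.
Variable E : confcat.
Hypothesis syzE : has_syzygies E.
Implicit Types X Y Z T W P : E.

Let kerE X Y Z (i : mor X Y) (p : mor Y Z) (c : conflation i p) :=
  proj1 (syz_kerP syzE c).
Let cokE X Y Z (i : mor X Y) (p : mor Y Z) (c : conflation i p) :=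
  proj2 (syz_kerP syzE c).

(** Pushing out along [f] reduces the extension problem to a retraction, which a section of the new
    epimorphism provides. *)
Lemma ext_orth_of_split X W :
  (forall (M : E) (i : mor W M) (p : mor M X), conflation i p ->
     exists s : mor X M, p ∘ s = idm X) ->
  ext_orth X W.
Proof.
move=> split A B i p conf f.
have [M [j [b [q [po conf' qb]]]]] := syz_pushout syzE f conf.
have [s qs] := split _ _ _ conf'.
have [|r jr] := kernel_lift (t := idm M - s ∘ q) (kerE conf').
  by rewrite compBr compmA qs comp1m compm1 subrr.
have rj : r ∘ j = idm W.
  apply: (kernel_mono (kerE conf')); rewrite compmA jr compBl -compmA.
  by rewrite (kernel_comp0 (kerE conf')) compm0 subr0 comp1m compm1.
by exists (r ∘ b); rewrite -compmA (pushout_square po) compmA rj comp1m.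
Qed.

(** The presentation maps to any extension of [X] by [W]. Extending the induced map [w] on kernels
    over [P] allows the lift [e] to be corrected so that it descends to a section. *)
Lemma ext_orth_of_presentation X W (A P : E) (i : mor A P) (p : mor P X) :
    conflation i p -> projective P ->
    (forall f : mor A W, exists g : mor P W, g ∘ i = f) ->
  ext_orth X W.
Proof.
move=> conf projP ext; apply: ext_orth_of_split => M j q conf'.
have [|e qe] := projP _ _ q _ p; first by exists W, j.
have [|w jw] := kernel_lift (t := e ∘ i) (kerE conf').
  by rewrite compmA qe (kernel_comp0 (kerE conf)).
have [h hi] := ext w.
have [|s sp] := cokernel_desc (t := e - j ∘ h) (cokE conf).
  by rewrite compBl -compmA hi jw subrr.
exists s; apply: (cokernel_epi (cokE conf)).
rewrite -compmA sp compBr qe compmA (kernel_comp0 (kerE conf')) comp0m.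
by rewrite subr0 comp1m.
Qed.

(** This is the exactness of Hom(X, M) -> Hom(X, X') -> Ext^1(X, W). *)
Lemma ext_orth_lift X W X' M (j : mor W M) (q : mor M X') (f : mor X X') :
  ext_orth X W -> conflation j q -> exists l : mor X M, q ∘ l = f.
Proof.
move=> orth conf; have [P [p [projP [A [i confp]]]]] := syz_enough syzE X.
have [|e qe] := projP _ _ q _ (f ∘ p); first by exists W, j.
have [|w jw] := kernel_lift (t := e ∘ i) (kerE conf).
  by rewrite compmA qe -compmA (kernel_comp0 (kerE confp)) compm0.
have [h hi] := orth _ _ _ _ confp w.
have [|l lp] := cokernel_desc (t := e - j ∘ h) (cokE confp).
  by rewrite compBl -compmA hi jw subrr.
exists l; apply: (cokernel_epi (cokE confp)).
by rewrite -compmA lp compBr qe compmA (kernel_comp0 (kerE conf)) comp0m subr0.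
Qed.

(** In the exact sequence Ext^1(X, T) -> Ext^1(X, W) -> Ext^2(X, K) the last group is Ext^1(A, K),
    because [P] is projective. *)
Lemma ext_orth_syzygy_shift X W (K T A P : E) (k : mor K T) (t : mor T W)
    (i : mor A P) (p : mor P X) :
    conflation k t -> conflation i p -> projective P ->
  ext_orth A K -> ext_orth X T -> ext_orth X W.
Proof.
move=> confk confi projP orthA orthX.
apply: (ext_orth_of_presentation confi projP) => f.
have [l tl] := ext_orth_lift f orthA confk.
have [g gi] := orthX _ _ _ _ confi l.
by exists (t ∘ g); rewrite -compmA gi tl.
Qed.

(** In the exact sequence Ext^1(T, W) -> Ext^1(K, W) -> Ext^2(G, W) the last group is Ext^1(G, W1),
    because [Q] is injective. *)
Lemma ext_orth_kernel (K T G W Q W1 : E) (k : mor K T) (e : mor T G)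
    (s : mor W Q) (t : mor Q W1) :
    conflation k e -> conflation s t -> injective_ob Q ->
  ext_orth T W -> ext_orth G W1 -> ext_orth K W.
Proof.
move=> confk confs injQ orthT orthG A B i p confi f.
have [|h hi] := injQ _ _ i _ (s ∘ f); first by exists K, p.
have [|u up] := cokernel_desc (t := t ∘ h) (cokE confi).
  by rewrite -compmA hi compmA (kernel_comp0 (kerE confs)) comp0m.
have [m mk] := orthG _ _ _ _ confk u.
have [l tl] := ext_orth_lift m orthT confs.
have [|g sg] := kernel_lift (t := h - l ∘ (k ∘ p)) (kerE confs).
  by rewrite compBr compmA tl compmA mk up subrr.
exists g; apply: (kernel_mono (kerE confs)); rewrite compmA sg compBl -!compmA.
by rewrite (kernel_comp0 (kerE confi)) !compm0 subr0 hi.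
Qed.

Lemma ext_orth_retraction X W M (i : mor W M) (p : mor M X) :
  ext_orth X W -> conflation i p -> exists r : mor M W, r ∘ i = idm W.
Proof. by move=> orth /orth /(_ (idm W)). Qed.

(** * Chosen syzygies and the vanishing of Yoneda extensions *)

Lemma syzygies : {syz : forall X, {A : E & {P : E & (mor A P * mor P X)%type}} |
  forall X, projective (projT1 (projT2 (syz X))) /\
    conflation (projT2 (projT2 (syz X))).1 (projT2 (projT2 (syz X))).2}.
Proof.
apply: cid; have ex X : exists s : {A : E & {P : E & (mor A P * mor P X)%type}},
    projective (projT1 (projT2 s)) /\
    conflation (projT2 (projT2 s)).1 (projT2 (projT2 s)).2.
  have [P [p [projP [A [i conf]]]]] := syz_enough syzE X.
  by exists (existT _ A (existT _ P (i, p))).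
by exists (fun X => sval (cid (ex X))) => X; exact: svalP (cid (ex X)).
Qed.

Definition syz X : E := projT1 (sval syzygies X).
Definition cover X : E := projT1 (projT2 (sval syzygies X)).
Definition syz_inc X : mor (syz X) (cover X) :=
  (projT2 (projT2 (sval syzygies X))).1.
Definition cover_pro X : mor (cover X) X :=
  (projT2 (projT2 (sval syzygies X))).2.

Lemma cover_projective X : projective (cover X).
Proof. exact: (proj1 (svalP syzygies X)). Qed.

Lemma syz_conf X : conflation (syz_inc X) (cover_pro X).
Proof. exact: (proj2 (svalP syzygies X)). Qed.

Definition syz_ses X : ses X (syz X) := Ses (syz_conf X).

Lemma cover_lift X X' K (s : ses X' K) (f : mor X X') :
  exists (e : mor (cover X) (mid s)) (k : mor (syz X) K),
    spro s ∘ e = f ∘ cover_pro X /\ e ∘ syz_inc X = sinc s ∘ k.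
Proof.
have [|e eqe] := @cover_projective X _ _ (spro s) _ (f ∘ cover_pro X).
  by exists K, (sinc s); exact: sconf.
have [|k eqk] := kernel_lift (t := e ∘ syz_inc X) (kerE (sconf s)).
  by rewrite compmA eqe -compmA (kernel_comp0 (kerE (syz_conf X))) compm0.
by exists e, k.
Qed.

Lemma yext_vanishes_of_weakly_initial m X W (c : yext m X W) :
  (forall s : yext m X W, yext_mor c s (idm X) (idm W)) -> Ext_vanishes m X W.
Proof.
move=> init; have eq_c s : yext_equiv s = yext_equiv c.
  apply: funext => s'; apply: propext.
  have cs s1 : yext_equiv c s1 by apply: rst_step.
  by split=> _; [exact: cs|apply: rst_trans (cs s'); apply: rst_sym; exact: cs].
case=> [a [s Ea]] [b [s' Eb]]; apply: eq_exist.
by rewrite Ea Eb !eq_c.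
Qed.

(* The tower of chosen projective covers of X, ending in a split extension,
   maps to every extension. *)
Lemma yext_weakly_initial m X W :
  (forall n, ext_orth (iter n syz X) W) ->
  exists c : yext m.+1 X W, forall X' (f : mor X X') (s : yext m.+1 X' W),
    yext_mor c s f (idm W).
Proof.
elim: m X => [|m IH] X orth.
  have [M [i [b [q [po conf qb]]]]] :=
    syz_pushout syzE (0 : mor (syz X) W) (syz_conf X).
  have [r ri] := ext_orth_retraction (orth 0%N) conf.
  exists (Ses conf) => X' f s.
  have [l sl] := ext_orth_lift f (orth 0%N) (sconf s).
  exists (l ∘ q + sinc s ∘ r) => /=; rewrite compDl compDr -!compmA ri.
  rewrite (kernel_comp0 (kerE conf)) compm0 add0r !compmA sl.
  by rewrite (kernel_comp0 (kerE (sconf s))) comp0m addr0.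
have [|c cP] := IH (syz X); first by move=> n; rewrite -iterSr; exact: orth.
exists (existT _ (syz X) (syz_ses X, c)) => X' f [K [s s']].
have [e [k [eqe eqk]]] := cover_lift s f.
by exists k; split; [exists e|exact: cP].
Qed.

Lemma ext_vanishes_of_orth X W :
  (forall n, ext_orth (iter n syz X) W) -> forall m, (0 < m)%N ->
  Ext_vanishes m X W.
Proof.
move=> orth [//|m] _; have [c cP] := yext_weakly_initial m orth.
by apply: (yext_vanishes_of_weakly_initial (c := c)) => s; exact: cP.
Qed.

(* [yext_null s f] says that the pullback of the extension s along f is
   trivial, computed with the chosen projective covers. *)
Fixpoint yext_null m X X' W : yext m.+1 X' W -> mor X X' -> Prop :=
  match m with
  | 0 => fun s f => exists l : mor X (mid s), spro s ∘ l = f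
  | m'.+1 => fun s f =>
      exists (e : mor (cover X) (mid (projT2 s).1))
             (k : mor (syz X) (projT1 s)),
        [/\ spro (projT2 s).1 ∘ e = f ∘ cover_pro X,
            e ∘ syz_inc X = sinc (projT2 s).1 ∘ k &
            @yext_null m' _ _ _ (projT2 s).2 k]
  end.

Lemma yext_null_projective m X X' W P (s : yext m.+1 X' W) (a : mor X P)
    (b : mor P X') :
  projective P -> yext_null s (b ∘ a).
Proof.
elim: m X X' P s a b => [|m IH] X X' P s a b projP.
  have [|l sl] := projP _ _ (spro s) _ b; first by exists W, (sinc s); case: s.
  by exists (l ∘ a); rewrite compmA sl.
case: s => K [s s'] /=; have [|l sl] := projP _ _ (spro s) _ b.
  by exists K, (sinc s); case: s.
exists (l ∘ a ∘ cover_pro X), 0; split.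
- by rewrite !compmA sl.
- by rewrite -!compmA (kernel_comp0 (kerE (syz_conf X))) !compm0.
- have := IH (syz X) K _ s' (0 : mor _ (cover X)) 0 (@cover_projective X).
  by rewrite comp0m.
Qed.

Lemma yext_nullB m X X' W (s : yext m.+1 X' W) (f g : mor X X') :
  yext_null s f -> yext_null s g -> yext_null s (f - g).
Proof.
elim: m X X' s f g => [|m IH] X X' s f g.
  by move=> [l <-] [l' <-]; exists (l - l'); rewrite compBr.
case: s => K [s s'] [e [k [/= se ek null]]] [e' [k' [/= se' ek' null']]].
exists (e - e'), (k - k'); split => /=.
- by rewrite compBr se se' compBl.
- by rewrite compBl ek ek' compBr.
- exact: IH.
Qed.

(** The definition asks for some lift [k1]. Two lifts differ by a map through [cover X], along which
    every pullback is trivial, so any lift will do. *)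
Lemma yext_null_lift m X X' K W (s : ses X' K) (s' : yext m.+1 K W)
    (f : mor X X') (e : mor (cover X) (mid s)) (k : mor (syz X) K) :
  spro s ∘ e = f ∘ cover_pro X -> e ∘ syz_inc X = sinc s ∘ k ->
  @yext_null m.+1 X X' W (existT _ K (s, s')) f -> yext_null s' k.
Proof.
move=> se ek [e1 [k1 [/= se1 ek1 null1]]].
have [|h sh] := kernel_lift (t := e1 - e) (kerE (sconf s)).
  by rewrite compBr se1 se subrr.
have -> : k = k1 - h ∘ syz_inc X.
  apply: (kernel_mono (kerE (sconf s))).
  by rewrite compBr compmA sh -ek1 -ek compBl opprB addrC subrK.
apply: yext_nullB => //; apply: yext_null_projective; exact: cover_projective.
Qed.

(** Triviality is invariant under the maps generating Yoneda equivalence. The general [a] serves the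
    induction, where the map between the first kernels takes its place. *)
Lemma yext_null_mor m X Y Y' W (s : yext m.+1 Y W) (s' : yext m.+1 Y' W)
    (a : mor Y Y') (f : mor X Y) :
  yext_mor s s' a (idm W) -> yext_null s' (a ∘ f) <-> yext_null s f.
Proof.
elim: m X Y Y' s s' a f => [|m IH] X Y Y' s s' a f.
  move=> [/= u [us su]]; split=> [[l' sl']|[l sl]]; last first.
    by exists (u ∘ l); rewrite compmA su -compmA sl.
  have [e [k [se ek]]] := cover_lift s f.
  have [|h sh] :=
      kernel_lift (t := u ∘ e - l' ∘ cover_pro X) (kerE (sconf s')).
    by rewrite compBr !compmA su sl' -!compmA se subrr.
  have hk : h ∘ syz_inc X = k.
    apply: (kernel_mono (kerE (sconf s'))).
    rewrite compmA sh compBl -!compmA ek (kernel_comp0 (kerE (syz_conf X))).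
    by rewrite compm0 subr0 compmA us compm1.
  have [|l lp] := cokernel_desc (t := e - sinc s ∘ h) (cokE (syz_conf X)).
    by rewrite compBl -compmA hk ek subrr.
  exists l; apply: (cokernel_epi (cokE (syz_conf X))).
  rewrite -compmA lp compBr se compmA (kernel_comp0 (kerE (sconf s))) comp0m.
  by rewrite subr0.
case: s s' => K [s t] [K' [s' t']] [/= b [[u [us su]] mor_t]].
split=> [null|[e [k [/= se ek null]]]]; last first.
  exists (u ∘ e), (b ∘ k); split=> /=.
  - by rewrite compmA su -compmA se compmA.
  - by rewrite -compmA ek !compmA us.
  - exact/(IH _ _ _ _ _ _ _ mor_t).
have [e [k [se ek]]] := cover_lift s f.
exists e, k; split=> //=; apply/(IH _ _ _ _ _ _ _ mor_t).
apply: (yext_null_lift (e := u ∘ e) _ _ null).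
- by rewrite compmA su -compmA se compmA.
- by rewrite -compmA ek !compmA us.
Qed.

Lemma yext_null_exists m X W : exists s : yext m.+1 X W, yext_null s (idm X).
Proof.
elim: m X => [|m IH] X.
  have [M [i [b [q [po conf qb]]]]] :=
    syz_pushout syzE (0 : mor (syz X) W) (syz_conf X).
  have [|l lp] := cokernel_desc (t := b) (cokE (syz_conf X)).
    by rewrite (pushout_square po) compm0.
  exists (Ses conf), l; apply: (cokernel_epi (cokE (syz_conf X))) => /=.
  by rewrite -compmA lp qb comp1m.
have [s null] := IH (syz X).
exists (existT _ (syz X) (syz_ses X, s)), (idm _), (idm _).
by split=> //=; rewrite ?comp1m ?compm1.
Qed.

(** Vanishing leaves a single class, which contains a null extension, and nullity is constant on
    classes. *)
Lemma yext_null_of_vanishes m X W (s : yext m.+1 X W) :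
  Ext_vanishes m.+1 X W -> yext_null s (idm X).
Proof.
move=> van; have [s0 null0] := yext_null_exists m X W.
have /(congr1 (fun c => sval c s)) := van
  (exist _ (yext_equiv s0) (ex_intro _ s0 erefl))
  (exist _ (yext_equiv s) (ex_intro _ s erefl)).
move=> /= equiv; have {equiv} : yext_equiv s0 s.
  by rewrite equiv; exact: rst_refl.
have gen s1 s2 : yext_equiv s1 s2 ->
    yext_null s1 (idm X) <-> yext_null s2 (idm X).
  elim=> {s1 s2} [s1 s2 mor12|//|s1 s2 _ [] //|s1 s2 s3 _ [h1 h2] _ [h3 h4]].
    by rewrite -(yext_null_mor _ mor12) comp1m.
  by split; auto.
by move/gen => [+ _]; apply.
Qed.

(** Splicing an extension of the [n]-th syzygy with the chosen covers yields a higher extension of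
    [X], null by hypothesis. Peeling the covers off again shows that the given extension is null,
    which in degree one means split. *)
Lemma ext_orth_of_vanishes X W :
  (forall m, (0 < m)%N -> Ext_vanishes m X W) ->
  forall n, ext_orth (iter n syz X) W.
Proof.
move=> van n; apply: ext_orth_of_split => M i p conf.
suff null m : forall s : yext m.+1 (iter n syz X) W, yext_null s (idm _).
  by have [s eqs] := null 0%N (Ses conf); exists s.
clear M i p conf; elim: n m => [|n IH] m s.
  by apply: yext_null_of_vanishes; exact: van.
set Y := iter n syz X in IH s *.
apply: (@yext_null_lift m Y Y (syz Y) W
  (syz_ses Y) s (idm Y) (idm _) (idm (syz Y)) _ _
  (IH m.+1 (existT _ _ (syz_ses Y, s)))).
  by rewrite comp1m compm1.
by rewrite comp1m compm1.
Qed.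

End Orthogonality.

(** * Finite coproducts *)

(** [List.In] asks for no decidable equality on [A], and repetitions are allowed. *)
Definition listable (A : Type) := exists s : seq A, forall a, List.In a s.

Lemma finite_set_listable (A : Type) :
  finite_set [set: A]%classic -> listable A.
Proof.
move=> finA; have /finite_seqP[s eqs] : finite_set [set: {classic A}]%classic.
  exact: finA.
exists s => a; have : [set` s]%classic (a : {classic A}) by rewrite -eqs.
rewrite /=; elim: s {eqs} => //= b s IH.
by rewrite inE => /orP[/eqP->|/IH]; [left|right].
Qed.

Lemma listable_sigT (A : Type) (B : A -> Type) :
  listable A -> (forall a, listable (B a)) -> listable {a : A & B a}.
Proof.
move=> [s sP] finB; pose t a := sval (cid (finB a)).
exists (List.flat_map (fun a => List.map (existT B a) (t a)) s) => -[a b].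
apply/List.in_flat_map; exists a; split=> //.
by apply/List.in_map_iff; exists b; split=> //; exact: (svalP (cid (finB a))).
Qed.

Lemma listable_unit : listable unit.
Proof. by exists [:: tt] => -[]; left. Qed.

Lemma finite_coproduct (C : preadditive) (A : Type) (X : A -> C) :
    is_additive C -> listable A ->
  exists (S : C) (inj : forall a, mor (X a) S),
    forall T (f : forall a, mor (X a) T),
    exists! h : mor S T, forall a, h ∘ inj a = f a.
Proof.
move=> [[Z Z0] bip] [s sP].
suff [S [inj [epi ex]]] : exists (S : C) (inj : forall a, mor (X a) S),
    (forall T (h h' : mor S T),
       (forall a, List.In a s -> h ∘ inj a = h' ∘ inj a) -> h = h') /\
    (forall T (f : forall a, mor (X a) T),
       exists h : mor S T, forall a, List.In a s -> h ∘ inj a = f a).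
  exists S, inj => T f; have [h hf] := ex T f; exists h.
  by split=> [a|h' h'f]; [exact: hf|apply: epi => a sa; rewrite hf// h'f].
elim: s {sP} => [|a s [S [inj [epi ex]]]].
  exists Z, (fun=> 0); split=> [T h h' _|T f]; last by exists 0.
  by rewrite (zero_mor_l h Z0) (zero_mor_l h' Z0).
(* An index that occurs again later in the list must not contribute a second summand. *)
have [sa|nsa] := pselect (List.In a s).
  exists S, inj; split=> [T h h' eqh|T f].
    by apply: epi => b sb; apply: eqh; right.
  by have [h hf] := ex T f; exists h => b [<-|/hf//]; exact: hf.
have [S' [iX [iS [pX [pS bipS]]]]] := bip (X a) S.
have [pXiX pSiS pXiS pSiX _] := bipS.
(* At an index [b] equal to [a] the injection is [iX] transported along the equality. Describing it
   by its properties avoids the cast. *)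
have /cid[inj' inj'P] : exists inj' : forall b, mor (X b) S', forall b,
    (b <> a -> inj' b = iS ∘ inj b) /\
    (forall T (h h' : mor S' T), b = a ->
       h ∘ inj' b = h' ∘ inj' b -> h ∘ iX = h' ∘ iX) /\
    (forall T (h : mor S' T) (f : forall b, mor (X b) T), b = a ->
       h ∘ iX = f a -> h ∘ inj' b = f b).
  suff ex' : forall b, exists g : mor (X b) S',
      (b <> a -> g = iS ∘ inj b) /\
      (forall T (h h' : mor S' T), b = a ->
         h ∘ g = h' ∘ g -> h ∘ iX = h' ∘ iX) /\
      (forall T (h : mor S' T) (f : forall b, mor (X b) T), b = a ->
         h ∘ iX = f a -> h ∘ g = f b).
    by exists (fun b => sval (cid (ex' b))) => b; exact: svalP (cid (ex' b)).
  move=> b; have [->|nba] := pselect (b = a); first by exists iX.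
  by exists (iS ∘ inj b).
have nb b : List.In b s -> b <> a by move=> + eqb; rewrite eqb.
exists S', inj'; split=> [T h h' eqh|T f].
  apply: (biproduct_ext_l bipS).
    by apply: (inj'P a).2.1 => //; apply: eqh; left.
  apply: epi => b sb; rewrite -!compmA -(inj'P b).1; last exact: nb.
  by apply: eqh; right.
have [h hf] := ex T f; exists (f a ∘ pX + h ∘ pS) => b [<-|sb].
  apply: (inj'P a).2.2 => //.
  by rewrite compDl -!compmA pXiX pSiX compm0 addr0 compm1.
rewrite (inj'P b).1; last exact: nb.
rewrite compDl -!compmA (compmA pX) pXiS (compmA pS) pSiS comp0m compm0 add0r.
by rewrite comp1m hf.
Qed.

(** * The termwise exact structure *)

(** The action on maps is often the unique solution of an equation. With the equation as [R],
    solutions are chosen once and functoriality follows from uniqueness. *)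
Lemma functor_of_unique (I C : category) (X : I -> C)
    (R : forall i j : I, mor i j -> mor (X i) (X j) -> Prop) :
    (forall i j (g : mor i j), exists r, R i j g r) ->
    (forall i j (g : mor i j) r r', R i j g r -> R i j g r' -> r = r') ->
    (forall i, R i i (idm i) (idm (X i))) ->
    (forall i j k (h : mor j k) (g : mor i j) r s,
       R j k h r -> R i j g s -> R i k (h ∘ g) (r ∘ s)) ->
  exists m : forall i j : I, mor i j -> mor (X i) (X j),
    [/\ forall i, m i i (idm i) = idm (X i),
        forall i j k (h : mor j k) (g : mor i j),
          m i k (h ∘ g) = m j k h ∘ m i j g &
        forall i j (g : mor i j), R i j g (m i j g)].
Proof.
move=> ex uniq R1 RM.
pose m i j (g : mor i j) := sval (cid (ex i j g)).
have mP i j g : R i j g (m i j g) by exact: svalP (cid (ex i j g)).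
by exists m; split=> // [i|i j k h g]; apply: uniq => //; exact: RM.
Qed.

Lemma nattrans_of_unique (I C : category) (X Y : functor I C)
    (R : forall i : I, mor (X i) (Y i) -> Prop) :
    (forall i, exists a, R i a) ->
    (forall i j (g : mor i j) a b, R i a -> R j b ->
       b ∘ fmor X g = fmor Y g ∘ a) ->
  exists n : nattrans X Y, forall i, R i (n i).
Proof.
move=> ex nat; pose n i := sval (cid (ex i)).
have nP i : R i (n i) by exact: svalP (cid (ex i)).
by exists (NatTrans (fun i j g => nat i j g _ _ (nP i) (nP j))).
Qed.

Section FunctorExact.
Variables (I : category) (F : confcat).
Hypothesis exF : is_exact F.
Local Notation FI := (functor_confcat I F).
Implicit Types X Y Z : FI.

Let kerF (X Y Z : F) (i : mor X Y) (p : mor Y Z) (c : conflation i p) :=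
  conf_kernel exF c.
Let cokF (X Y Z : F) (i : mor X Y) (p : mor Y Z) (c : conflation i p) :=
  conf_cokernel exF c.

Lemma nat_compE X Y Z (b : mor Y Z) (a : mor X Y) (x : I) :
  (b ∘ a : nattrans X Z) x = (b : nattrans Y Z) x ∘ (a : nattrans X Y) x.
Proof. by []. Qed.

Lemma functor_conf_kernel X Y Z (i : mor X Y) (p : mor Y Z) :
  conflation i p -> is_kernel i p.
Proof.
move=> conf; have kerx x := kerF (conf x).
apply: is_kernelP => [|T f g eqi|T t pt].
- by apply: nattransP => x; exact: (kernel_comp0 (kerx x)).
- apply: nattransP => x; apply: (kernel_mono (kerx x)).
  by rewrite -!nat_compE eqi.
- have ptx x : p x ∘ t x = 0 by rewrite -nat_compE pt.
  have [||n nP] := @nattrans_of_unique I F T X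
      (fun x a => (i : nattrans X Y) x ∘ a = (t : nattrans T Y) x).
  + by move=> x; exact: (kernel_lift (kerx x)).
  + move=> x y g a b eqa eqb; apply: (kernel_mono (kerx y)).
    by rewrite !compmA eqb !naturality -compmA eqa.
  + by exists n; apply: nattransP.
Qed.

Lemma functor_conf_cokernel X Y Z (i : mor X Y) (p : mor Y Z) :
  conflation i p -> is_cokernel i p.
Proof.
move=> conf; have cokx x := cokF (conf x).
apply: is_cokernelP => [|T f g eqp|T t ti].
- by apply: nattransP => x; exact: (cokernel_comp0 (cokx x)).
- apply: nattransP => x; apply: (cokernel_epi (cokx x)).
  by rewrite -!nat_compE eqp.
- have tix x : t x ∘ i x = 0 by rewrite -nat_compE ti.
  have [||n nP] := @nattrans_of_unique I F Z T
      (fun x a => a ∘ (p : nattrans Y Z) x = (t : nattrans Y T) x).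
  + by move=> x; exact: (cokernel_desc (cokx x)).
  + move=> x y g a b eqa eqb; apply: (cokernel_epi (cokx x)).
    by rewrite -!compmA -naturality compmA eqb eqa naturality.
  + by exists n; apply: nattransP.
Qed.

Lemma functor_cokernel X Y (i : mor X Y) :
  (forall x, admissible_mono ((i : nattrans X Y) x)) -> admissible_mono i.
Proof.
move=> mi; pose Z x := sval (cid (mi x)).
have /cid[p pP] : exists p : forall x, mor (Y x) (Z x),
    forall x, conflation ((i : nattrans X Y) x) (p x).
  exists (fun x => sval (cid (svalP (cid (mi x))))) => x.
  exact: svalP (cid (svalP (cid (mi x)))).
have cokx x := cokF (pP x).
have [||||m [m1 mM mP]] := @functor_of_unique I F Z
    (fun x y g r => r ∘ p x = p y ∘ fmor Y g).
- move=> x y g; apply: (cokernel_desc (cokx x)).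
  by rewrite -compmA -naturality compmA (cokernel_comp0 (cokx y)) comp0m.
- by move=> x y g r r' eqr eqr'; apply: (cokernel_epi (cokx x)); rewrite eqr.
- by move=> x; rewrite fmor1 comp1m compm1.
- by move=> x y z h g r s eqr eqs; rewrite fmorM compmA -eqr -!compmA eqs.
by exists (Functor m1 mM), (@NatTrans _ _ _ (Functor m1 mM) p
  (fun x y g => esym (mP x y g))).
Qed.

Lemma functor_kernel Y Z (p : mor Y Z) :
  (forall x, admissible_epi ((p : nattrans Y Z) x)) -> admissible_epi p.
Proof.
move=> ep; pose X x := sval (cid (ep x)).
have /cid[i iP] : exists i : forall x, mor (X x) (Y x),
    forall x, conflation (i x) ((p : nattrans Y Z) x).
  exists (fun x => sval (cid (svalP (cid (ep x))))) => x.
  exact: svalP (cid (svalP (cid (ep x)))).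
have kerx x := kerF (iP x).
have [||||m [m1 mM mP]] := @functor_of_unique I F X
    (fun x y g r => i y ∘ r = fmor Y g ∘ i x).
- move=> x y g; apply: (kernel_lift (kerx y)).
  by rewrite compmA naturality -compmA (kernel_comp0 (kerx x)) compm0.
- by move=> x y g r r' eqr eqr'; apply: (kernel_mono (kerx y)); rewrite eqr.
- by move=> x; rewrite fmor1 comp1m compm1.
- by move=> x y z h g r s eqr eqs; rewrite fmorM -compmA -eqs !compmA eqr.
by exists (Functor m1 mM), (@NatTrans _ _ (Functor m1 mM) _ i mP).
Qed.

(** The termwise pushouts form a functor by their universal property. *)
Lemma functor_conf_pushout X Y Z X' (i : mor X Y) (p : mor Y Z) (a : mor X X') :
  conflation i p ->
  exists (Y' : FI) (i' : mor X' Y') (b : mor Y Y') (q : mor Y' Z),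
    [/\ is_pushout i a i' b, conflation i' q & q ∘ b = p].
Proof.
move=> conf.
have ex x := conf_pushout exF ((a : nattrans X X') x) (conf x).
pose Y' x := sval (cid (ex x)).
have /cid[i' /cid[b /cid[q P]]] : exists (i' : forall x, mor (X' x) (Y' x))
    (b : forall x, mor (Y x) (Y' x)) (q : forall x, mor (Y' x) (Z x)),
    forall x, [/\ is_pushout ((i : nattrans X Y) x) ((a : nattrans X X') x)
      (i' x) (b x), conflation (i' x) (q x) &
      q x ∘ b x = (p : nattrans Y Z) x].
  pose e1 x := cid (svalP (cid (ex x))); pose e2 x := cid (svalP (e1 x)).
  pose e3 x := cid (svalP (e2 x)).
  by exists (fun x => sval (e1 x)), (fun x => sval (e2 x)),
    (fun x => sval (e3 x)) => x; exact: svalP (e3 x).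
have po x : is_pushout ((i : nattrans X Y) x) ((a : nattrans X X') x)
  (i' x) (b x) by have [] := P x.
have [||||m [m1 mM mP]] := @functor_of_unique I F Y'
    (fun x y g r => r ∘ b x = b y ∘ fmor Y g /\ r ∘ i' x = i' y ∘ fmor X' g).
- move=> x y g; apply: (pushout_desc (po x)).
  by rewrite -!compmA -!naturality !compmA (pushout_square (po y)).
- move=> x y g r r' [rb ri] [r'b r'i].
  by apply: (pushout_epi (po x)); rewrite ?rb ?ri.
- by move=> x; rewrite !fmor1 !comp1m !compm1.
- move=> x y z h g r s [rb ri] [sb si].
  by rewrite !fmorM !compmA -rb -ri -!compmA sb si.
pose Yf : FI := Functor m1 mM.
pose i'n : @mor FI X' Yf :=
  @NatTrans _ _ X' Yf i' (fun x y g => esym (mP x y g).2).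
pose bn : @mor FI Y Yf :=
  @NatTrans _ _ Y Yf b (fun x y g => esym (mP x y g).1).
have [||qn qnP] := @nattrans_of_unique I F Yf Z (fun x r => r = q x).
- by move=> x; exists (q x).
- move=> x y g _ _ -> ->; have [_ _ qbx] := P x; have [_ _ qby] := P y.
  have [mb mi] := mP x y g; have [_ cx _] := P x; have [_ cy _] := P y.
  apply: (pushout_epi (po x)).
    by rewrite -!compmA mb qbx compmA qby naturality.
  rewrite -!compmA mi (kernel_comp0 (kerF cx)) compmA.
  by rewrite (kernel_comp0 (kerF cy)) comp0m compm0.
exists Yf, i'n, bn, qn; split.
- split; first by apply: nattransP => x; exact: (pushout_square (po x)).
  move=> T s t eqst.
  have eqx x : (s : nattrans Y T) x ∘ (i : nattrans X Y) x =
      (t : nattrans X' T) x ∘ (a : nattrans X X') x.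
    by rewrite -!nat_compE eqst.
  have [||n nP] := @nattrans_of_unique I F Yf T (fun x r =>
      r ∘ b x = (s : nattrans Y T) x /\ r ∘ i' x = (t : nattrans X' T) x).
  + by move=> x; exact: (pushout_desc (po x)).
  + move=> x y g r r' [rb ri] [r'b r'i]; have [mb mi] := mP x y g.
    apply: (pushout_epi (po x)).
      by rewrite -!compmA mb rb compmA r'b naturality.
    by rewrite -!compmA mi ri compmA r'i naturality.
  exists n; split.
    by split; apply: nattransP => x; have [] := nP x.
  move=> n' [n'b n'i]; apply: nattransP => x; have [nb ni] := nP x.
  apply: (pushout_epi (po x)).
    by rewrite nb -n'b.
  by rewrite ni -n'i.
- by move=> x; rewrite qnP; have [] := P x.
- by apply: nattransP => x /=; rewrite qnP; have [] := P x.
Qed.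

End FunctorExact.

(** * Free and cofree functors *)

(* L is the sum over a of the left Kan extensions of the objects [X a] along
   the functors [v a] from the terminal category: the value [L j] is the
   coproduct of the [X a] over all pairs of an a and a map from [v a] to j. *)
Definition is_free_functor (J C : category) (A : Type) (v : A -> J) (X : A -> C)
    (L : functor J C) (unit : forall a, mor (X a) (L (v a))) :=
  forall (j : J) (T : C) (f : forall a, mor (v a) j -> mor (X a) T),
  exists! h : mor (L j) T,
    forall a (g : mor (v a) j), h ∘ (fmor L g ∘ unit a) = f a g.

(** The dual notion: [R j] is the product of the [X a] over all pairs of an [a] and a map from [j]
    to [v a]. *)
Definition is_cofree_functor (J C : category) (A : Type) (v : A -> J)
    (X : A -> C) (R : functor J C) (counit : forall a, mor (R (v a)) (X a)) :=
  forall (j : J) (T : C) (f : forall a, mor j (v a) -> mor T (X a)),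
  exists! h : mor T (R j),
    forall a (g : mor j (v a)), (counit a ∘ fmor R g) ∘ h = f a g.

(** Maps of [J] act on the coproduct by postcomposition on its index set, and the unit is the
    injection at the identity. *)
Lemma free_functor_exists (J : category) (C : preadditive) (A : Type)
    (v : A -> J) (X : A -> C) :
    is_additive C -> listable A -> (forall i j : J, listable (mor i j)) ->
  exists (L : functor J C) (unit : forall a, mor (X a) (L (v a))),
    is_free_functor unit.
Proof.
move=> addC finA finJ.
have ex j := @finite_coproduct C {a : A & mor (v a) j} (fun x => X (projT1 x))
  addC (listable_sigT finA (fun a => finJ (v a) j)).
pose L j := sval (cid (ex j)).
pose e1 j := cid (svalP (cid (ex j))).
pose inj a j (g : mor (v a) j) : mor (X a) (L j) := sval (e1 j) (existT _ a g).
have injP j T (f : forall a, mor (v a) j -> mor (X a) T) :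
    exists! h : mor (L j) T, forall a g, h ∘ inj a j g = f a g.
  have [h [hf uniq_h]] := svalP (e1 j) T (fun x => f (projT1 x) (projT2 x)).
  exists h; split=> [a g|h' h'f]; first exact: (hf (existT _ a g)).
  by apply: uniq_h => -[a g]; exact: h'f.
have inj_ext j T (h h' : mor (L j) T) :
    (forall a g, h ∘ inj a j g = h' ∘ inj a j g) -> h = h'.
  move=> eqh; have [h1 [_ uniq_h]] := injP j T (fun a g => h' ∘ inj a j g).
  by rewrite -(uniq_h h eqh) -(uniq_h h').
have [||||m [m1 mM mP]] := @functor_of_unique J C L
    (fun i j g r => forall a h, r ∘ inj a i h = inj a j (g ∘ h)).
- move=> i j g; have [h [hf _]] := injP i _ (fun a h => inj a j (g ∘ h)).
  by exists h.
- by move=> i j g r r' rP r'P; apply: inj_ext => a h; rewrite rP.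
- by move=> i a h; rewrite !comp1m.
- by move=> i j k h g r s rP sP a w; rewrite -compmA sP rP compmA.
exists (Functor m1 mM), (fun a => inj a (v a) (idm (v a))) => j T f.
have [h [hf uniq_h]] := injP j T f; exists h; split=> [a g|h' h'f].
  by rewrite /= mP compm1.
by apply: uniq_h => a g; rewrite -h'f /= mP compm1.
Qed.

Definition unop_functor (J C : category)
    (T : functor (op_category J) (op_category C)) : functor J C :=
  @Functor J C T (fun i j g => @fmor _ _ T j i g) (@fmor1 _ _ T)
    (fun i j k h g => @fmorM _ _ T k j i g h).

Lemma cofree_functor_exists (J : category) (C : preadditive) (A : Type)
    (v : A -> J) (X : A -> C) :
    is_additive C -> listable A -> (forall i j : J, listable (mor i j)) ->
  exists (R : functor J C) (counit : forall a, mor (R (v a)) (X a)),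
    is_cofree_functor counit.
Proof.
move=> addC finA finJ.
have [L [unit Lfree]] := @free_functor_exists (op_category J)
  (op_preadditive C) A v X (is_additive_op addC) finA (fun i j => finJ j i).
by exists (unop_functor L), unit.
Qed.

Section FreeFunctor.
Variables (J C : category) (A : Type) (v : A -> J) (X : A -> C).
Variables (L : functor J C) (unit : forall a, mor (X a) (L (v a))).
Hypothesis freeL : is_free_functor unit.

Lemma free_mor j T (f : forall a, mor (v a) j -> mor (X a) T) :
  exists h : mor (L j) T,
    forall a (g : mor (v a) j), h ∘ (fmor L g ∘ unit a) = f a g.
Proof. by have [h [hf _]] := freeL f; exists h. Qed.

Lemma free_mor_ext j T (h h' : mor (L j) T) :
  (forall a (g : mor (v a) j),
     h ∘ (fmor L g ∘ unit a) = h' ∘ (fmor L g ∘ unit a)) -> h = h'.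
Proof.
move=> eqh; have [h1 [_ uniq_h]] :=
  freeL (fun a (g : mor (v a) j) => h' ∘ (fmor L g ∘ unit a)).
by rewrite -(uniq_h h eqh) -(uniq_h h').
Qed.

Lemma free_nat (Y : functor J C) (f : forall a, mor (X a) (Y (v a))) :
  exists n : nattrans L Y, forall a, n (v a) ∘ unit a = f a.
Proof.
have [||n nP] := @nattrans_of_unique J C L Y
  (fun j r => forall a g, r ∘ (fmor L g ∘ unit a) = fmor Y g ∘ f a).
- by move=> j; exact: free_mor.
- move=> i j g r r' rP r'P; apply: free_mor_ext => a h.
  by rewrite -!compmA rP (compmA (fmor L g)) -fmorM r'P fmorM -compmA.
exists n => a; have := nP (v a) a (idm _).
by rewrite !fmor1 !comp1m.
Qed.

Lemma free_nat_ext (Y : functor J C) (n n' : nattrans L Y) :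
  (forall a, n (v a) ∘ unit a = n' (v a) ∘ unit a) -> n = n'.
Proof.
move=> eqn; apply: nattransP => j; apply: free_mor_ext => a g.
by rewrite !compmA !naturality -!compmA eqn.
Qed.

End FreeFunctor.

Section CofreeFunctor.
Variables (J C : category) (A : Type) (v : A -> J) (X : A -> C).
Variables (R : functor J C) (counit : forall a, mor (R (v a)) (X a)).
Hypothesis cofreeR : is_cofree_functor counit.

Lemma cofree_mor j T (f : forall a, mor j (v a) -> mor T (X a)) :
  exists h : mor T (R j),
    forall a (g : mor j (v a)), (counit a ∘ fmor R g) ∘ h = f a g.
Proof. by have [h [hf _]] := cofreeR f; exists h. Qed.

Lemma cofree_mor_ext j T (h h' : mor T (R j)) :
  (forall a (g : mor j (v a)),
     (counit a ∘ fmor R g) ∘ h = (counit a ∘ fmor R g) ∘ h') -> h = h'.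
Proof.
move=> eqh; have [h1 [_ uniq_h]] :=
  cofreeR (fun a (g : mor j (v a)) => (counit a ∘ fmor R g) ∘ h').
by rewrite -(uniq_h h eqh) -(uniq_h h').
Qed.

Lemma cofree_nat (Y : functor J C) (f : forall a, mor (Y (v a)) (X a)) :
  exists n : nattrans Y R, forall a, counit a ∘ n (v a) = f a.
Proof.
have [||n nP] := @nattrans_of_unique J C Y R
  (fun j r => forall a g, (counit a ∘ fmor R g) ∘ r = f a ∘ fmor Y g).
- by move=> j; exact: cofree_mor.
- move=> i j g r r' rP r'P; apply: cofree_mor_ext => a h.
  by rewrite !compmA r'P -(compmA (counit a)) -fmorM rP fmorM compmA.
exists n => a; have := nP (v a) a (idm _).
by rewrite !fmor1 !compm1.
Qed.

Lemma cofree_nat_ext (Y : functor J C) (n n' : nattrans Y R) :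
  (forall a, counit a ∘ n (v a) = counit a ∘ n' (v a)) -> n = n'.
Proof.
move=> eqn; apply: nattransP => j; apply: cofree_mor_ext => a g.
by rewrite -!compmA -!naturality !compmA eqn.
Qed.

End CofreeFunctor.

Lemma projective_retract (E : confcat) (P P' : E)
    (s : mor P' P) (r : mor P P') :
  r ∘ s = idm P' -> projective P -> projective P'.
Proof.
move=> rs projP Y Z p ep f; have [g pg] := projP _ _ p ep (f ∘ r).
by exists (g ∘ s); rewrite compmA pg -compmA rs compm1.
Qed.

(** * Projective, injective, free and cofree diagrams *)

Section FunctorProjectives.
Variables (J : category) (F : confcat).
Hypothesis exF : is_exact F.
Hypothesis wicF : weakly_idempotent_complete F.
Hypothesis finJ : listable J.
Hypothesis finhomJ : forall i j : J, listable (mor i j).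
Local Notation FJ := (functor_confcat J F).

Definition termwise_projective (W : FJ) := forall j : J, projective (W j).

Lemma functor_admissible_epi (Y Z : FJ) (p : mor Y Z) (j : J) :
  admissible_epi p -> admissible_epi ((p : nattrans Y Z) j).
Proof. by case=> K [i conf]; exists (K j), ((i : nattrans K Y) j). Qed.

Lemma functor_admissible_mono (Y Z : FJ) (p : mor Y Z) (j : J) :
  admissible_mono p -> admissible_mono ((p : nattrans Y Z) j).
Proof. by case=> K [i conf]; exists (K j), ((i : nattrans Z K) j). Qed.

Lemma free_projective (A : Type) (v : A -> J) (X : A -> F) (L : FJ)
    (unit : forall a, mor (X a) (L (v a))) :
  is_free_functor unit -> (forall a, projective (X a)) -> projective L.
Proof.
move=> freeL projX Y Z p ep f.
have /cid[g gP] : exists g : forall a, mor (X a) (Y (v a)),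
    forall a, (p : nattrans Y Z) (v a) ∘ g a
      = (f : nattrans L Z) (v a) ∘ unit a.
  pose e a := cid (projX a _ _ _ (functor_admissible_epi (v a) ep)
    ((f : nattrans L Z) (v a) ∘ unit a)).
  by exists (fun a => sval (e a)) => a; exact: svalP (e a).
have [n nP] := free_nat freeL g; exists n.
by apply: (free_nat_ext freeL) => a; rewrite /= -compmA nP gP.
Qed.

Lemma free_termwise_projective (A : Type) (v : A -> J) (X : A -> F) (L : FJ)
    (unit : forall a, mor (X a) (L (v a))) :
  is_free_functor unit -> (forall a, projective (X a)) -> termwise_projective L.
Proof.
move=> freeL projX j Y Z p ep f.
have /cid[g gP] : exists g : forall a, mor (v a) j -> mor (X a) Y,
    forall a h, p ∘ g a h = f ∘ (fmor L h ∘ unit a).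
  pose e a h := cid (projX a _ _ _ ep (f ∘ (fmor L h ∘ unit a))).
  by exists (fun a h => sval (e a h)) => a h; exact: svalP (e a h).
have [h hP] := free_mor freeL g; exists h.
by apply: (free_mor_ext freeL) => a w; rewrite -compmA hP gP.
Qed.

Lemma cofree_injective (A : Type) (v : A -> J) (X : A -> F) (R : FJ)
    (counit : forall a, mor (R (v a)) (X a)) :
  is_cofree_functor counit -> (forall a, injective_ob (X a)) -> injective_ob R.
Proof.
move=> cofreeR injX Y Z i mi f.
have /cid[g gP] : exists g : forall a, mor (Z (v a)) (X a),
    forall a, g a ∘ (i : nattrans Y Z) (v a)
      = counit a ∘ (f : nattrans Y R) (v a).
  pose e a := cid (injX a _ _ _ (functor_admissible_mono (v a) mi)
    (counit a ∘ (f : nattrans Y R) (v a))).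
  by exists (fun a => sval (e a)) => a; exact: svalP (e a).
have [n nP] := cofree_nat cofreeR g; exists n.
by apply: (cofree_nat_ext cofreeR) => a; rewrite /= compmA nP gP.
Qed.

Lemma cofree_termwise_injective (A : Type) (v : A -> J) (X : A -> F) (R : FJ)
    (counit : forall a, mor (R (v a)) (X a)) :
  is_cofree_functor counit -> (forall a, injective_ob (X a)) ->
  forall j, injective_ob (R j).
Proof.
move=> cofreeR injX j Y Z i mi f.
have /cid[g gP] : exists g : forall a, mor j (v a) -> mor Z (X a),
    forall a h, g a h ∘ i = (counit a ∘ fmor R h) ∘ f.
  pose e a h := cid (injX a _ _ _ mi ((counit a ∘ fmor R h) ∘ f)).
  by exists (fun a h => sval (e a h)) => a h; exact: svalP (e a h).
have [h hP] := cofree_mor cofreeR g; exists h.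
by apply: (cofree_mor_ext cofreeR) => a w; rewrite compmA hP gP.
Qed.

(** The units split [e] at each object, in general not naturally. The retractions [r] let termwise
    projectivity pass from [T] to [K]. *)
Lemma free_resolution (X : FJ) :
  exists (K T : FJ) (k : mor K T) (e : mor T X)
    (unit : forall j, mor (X j) (T j)),
    [/\ conflation k e, @is_free_functor J F J id X T unit,
        forall j, (e : nattrans T X) j ∘ unit j = idm (X j) &
        forall j, exists r : mor (T j) (K j),
          r ∘ (k : nattrans K T) j = idm (K j)].
Proof.
have [T [unit freeT]] :=
  free_functor_exists id X (exact_additive exF) finJ finhomJ.
have [e eP] := free_nat freeT (fun j => idm (X j)).
have split_e j : admissible_epi (e j).
  have [Z [t [p [pt ps rt sum]]]] := retraction_kernel wicF (eP j).
  exists Z, t.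
  by have [] := split_conf exF (And4 pt ps rt sum) (eP j).
have [K [k conf]] := functor_kernel exF (p := e : @mor FJ T X) split_e.
exists K, T, k, e, unit; split=> // j.
have kerj := conf_kernel exF (conf j).
have [|r kr] := kernel_lift (t := idm (T j) - unit j ∘ e j) kerj.
  by rewrite compBr compmA eP comp1m compm1 subrr.
exists r; apply: (kernel_mono kerj).
rewrite compmA kr compBl -compmA (kernel_comp0 kerj) compm0 subr0.
by rewrite comp1m compm1.
Qed.

Lemma cofree_coresolution (X : FJ) :
  exists (Q C : FJ) (s : mor X Q) (q : mor Q C)
    (counit : forall j, mor (Q j) (X j)),
    [/\ conflation s q, @is_cofree_functor J F J id X Q counit &
        forall j, exists r : mor (C j) (Q j),
          (q : nattrans Q C) j ∘ r = idm (C j)].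
Proof.
have [Q [counit cofreeQ]] :=
  cofree_functor_exists id X (exact_additive exF) finJ finhomJ.
have [s sP] := cofree_nat cofreeQ (fun j => idm (X j)).
have split_s j : admissible_mono (s j).
  have [Z [t [p [pt ps rt sum]]]] := retraction_kernel wicF (sP j).
  exists Z, p.
  by have [] := split_conf exF (And4 pt ps rt sum) (sP j).
have [C [q conf]] := functor_cokernel exF (i := s : @mor FJ X Q) split_s.
exists Q, C, s, q, counit; split=> // j.
have cokj := conf_cokernel exF (conf j).
have [|r rq] := cokernel_desc (t := idm (Q j) - s j ∘ counit j) cokj.
  by rewrite compBl -compmA sP comp1m compm1 subrr.
exists r; apply: (cokernel_epi cokj).
rewrite -compmA rq compBr compmA (cokernel_comp0 cokj) comp0m subr0.
by rewrite comp1m compm1.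
Qed.

Hypothesis enoughF : enough_projectives F.

(** [P] is freely generated by projectives mapping onto the values of [X]. Already [p ∘ unit] is an
    admissible epimorphism at each object, so [p] is one by weak idempotent completeness. *)
Lemma functor_enough_projectives (X : FJ) :
  exists (P : FJ) (p : mor P X),
    [/\ projective P, termwise_projective P & admissible_epi p].
Proof.
pose c j := cid (enoughF (X j)); pose d j := cid (svalP (c j)).
have [P [unit freeP]] := free_functor_exists id (fun j => sval (c j))
  (exact_additive exF) finJ finhomJ.
have projc j : projective (sval (c j)) by have [] := svalP (d j).
have [p pP] := free_nat freeP (fun j => sval (d j)).
exists P, p; split.
- exact: (free_projective freeP).
- exact: (free_termwise_projective freeP).
apply: (functor_kernel exF) => j.
apply: (admissible_epi_factor exF wicF (f := unit j)); rewrite pP.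
by have [] := svalP (d j).
Qed.

Lemma functor_has_syzygies : has_syzygies FJ.
Proof.
split.
- move=> X Y Z i p conf.
  by split; [exact: functor_conf_kernel|exact: functor_conf_cokernel].
- by move=> X Y Z X' i p a; exact: functor_conf_pushout.
- move=> X; have [P [p [projP _ ep]]] := functor_enough_projectives X.
  by exists P, p.
Qed.

Lemma projective_termwise (P : FJ) : projective P -> termwise_projective P.
Proof.
move=> projP j; have [P' [p [_ tprojP' ep]]] := functor_enough_projectives P.
have [s ps] := projP _ _ p ep (idm P).
apply: (projective_retract (s := (s : nattrans P P') j)
  (r := (p : nattrans P' P) j)) => //.
by rewrite -nat_compE ps.
Qed.

(** An extension of [L] by [W] splits at each [v a], where [W] is injective. Lifting the generators
    there determines a section on the free functor. *)
Lemma free_ext_orth (A : Type) (v : A -> J) (X : A -> F) (L W : FJ)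
    (unit : forall a, mor (X a) (L (v a))) :
    (forall Q : F, projective Q -> injective_ob Q) ->
  is_free_functor unit -> termwise_projective W -> ext_orth L W.
Proof.
move=> proj_inj freeL projW; apply: (ext_orth_of_split functor_has_syzygies).
move=> M i p conf.
have /cid[g gP] : exists g : forall a, mor (X a) (M (v a)),
    forall a, (p : nattrans M L) (v a) ∘ g a = unit a.
  suff ex a : exists g : mor (X a) (M (v a)),
      (p : nattrans M L) (v a) ∘ g = unit a.
    by exists (fun a => sval (cid (ex a))) => a; exact: svalP (cid (ex a)).
  have cok := conf_cokernel exF (conf (v a)).
  have [|r ri] := proj_inj _ (projW (v a)) _ _
      ((i : nattrans W M) (v a)) _ (idm (W (v a))).
    by exists (L (v a)), ((p : nattrans M L) (v a)); exact: conf.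
  have [|s sp] := cokernel_desc
      (t := idm (M (v a)) - (i : nattrans W M) (v a) ∘ r) cok.
    by rewrite compBl -compmA ri comp1m compm1 subrr.
  exists (s ∘ unit a); rewrite compmA.
  suff -> : (p : nattrans M L) (v a) ∘ s = idm _ by rewrite comp1m.
  apply: (cokernel_epi cok); rewrite -compmA sp compBr compmA.
  by rewrite (cokernel_comp0 cok) comp0m subr0 comp1m compm1.
have [n nP] := free_nat freeL g; exists n.
by apply: (free_nat_ext freeL) => a; rewrite /= -compmA nP gP comp1m.
Qed.

End FunctorProjectives.

(** * Gorenstein projective diagrams over a Frobenius category *)

Section FrobeniusDiagrams.
Variables (J : category) (F : confcat).
Hypothesis frobF : is_frobenius F.
Hypothesis wicF : weakly_idempotent_complete F.
Hypothesis finJ : listable J.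
Hypothesis finhomJ : forall i j : J, listable (mor i j).
Local Notation FJ := (functor_confcat J F).

Let exF : is_exact F. Proof. by case: frobF. Qed.
Let enoughP : enough_projectives F. Proof. by case: frobF. Qed.
Let syzFJ : has_syzygies FJ :=
  functor_has_syzygies exF wicF finJ finhomJ enoughP.

Lemma frobenius_proj_inj (Q : F) : projective Q -> injective_ob Q.
Proof. by case: frobF => _ _ _ /(_ Q)[]. Qed.

Lemma frobenius_inj_proj (Q : F) : injective_ob Q -> projective Q.
Proof. by case: frobF => _ _ _ /(_ Q)[]. Qed.

Definition orth_termwise_projective (X : FJ) :=
  forall W : FJ, termwise_projective W -> ext_orth X W.

Lemma orth_projective (P : FJ) : projective P -> orth_termwise_projective P.
Proof.
move=> projP W _; apply: (ext_orth_of_split syzFJ) => M i p conf.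
by apply: projP; exists W, i.
Qed.

Lemma orth_free (A : Type) (v : A -> J) (X : A -> F) (L : FJ)
    (unit : forall a, mor (X a) (L (v a))) :
  is_free_functor unit -> orth_termwise_projective L.
Proof.
move=> freeL W projW.
exact: (free_ext_orth exF wicF finJ finhomJ enoughP frobenius_proj_inj freeL).
Qed.

(** The cosyzygy [C] of [W] is termwise a retract of an injective, hence termwise projective as [F]
    is Frobenius. The shift of [ext_orth_kernel] thus stays within the test class. *)
Lemma orth_kernel (K T G : FJ) (k : mor K T) (e : mor T G) :
    conflation k e ->
  orth_termwise_projective T -> orth_termwise_projective G ->
  orth_termwise_projective K.
Proof.
move=> conf orthT orthG W projW.
have [Q [C [s [q [counit [confs cofreeQ split_q]]]]]] :=
  cofree_coresolution exF wicF finJ finhomJ W.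
have injW j : injective_ob (W j) by apply: frobenius_proj_inj.
apply: (ext_orth_kernel syzFJ conf confs) => //.
- exact: (cofree_injective cofreeQ).
- exact: orthT.
apply: orthG => j; have [r qr] := split_q j.
apply: (projective_retract qr); apply: frobenius_inj_proj.
exact: (cofree_termwise_injective cofreeQ).
Qed.

(** All syzygies of [X] stay in the class by [orth_kernel], and their Ext^1 into [P] controls the
    higher Ext of [X]. *)
Lemma gorenstein_projective_of_orth (X : FJ) :
  orth_termwise_projective X -> gorenstein_projective X.
Proof.
move=> orthX P projP; apply: (@ext_vanishes_of_orth _ syzFJ X P) => n.
have projP' : termwise_projective P.
  exact: (projective_termwise exF wicF finJ finhomJ enoughP).
suff orthn : orth_termwise_projective (iter n (syz syzFJ) X) by exact: orthn.
elim: n => //= n IH; apply: (orth_kernel (syz_conf syzFJ _)) => //.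
by apply: orth_projective; exact: cover_projective.
Qed.

(** * Induction on degrees in a direct category *)

Section Direct.
Variables (n : nat) (d : J -> 'I_n.+1).
Hypothesis dP :
  forall (i j : J) (f : mor i j), ~ is_identity f -> (d i < d j)%N.

Definition zero_below (k : nat) (X : FJ) :=
  forall j : J, (d j < k)%N -> idm (X j) = 0.

Lemma zero_above_mor (X Y : FJ) (f : mor X Y) (k : nat) :
  (n < k)%N -> zero_below k X -> f = 0.
Proof.
move=> ltnk X0; apply: nattransP => j; apply: zero_mor_l; apply: X0.
exact: leq_trans (ltn_ord _) ltnk.
Qed.

(* In degree k the resolution T of X is X itself, all non-identity maps into
   this degree coming from objects where X vanishes. *)
Lemma resolution_zero_below (k : nat) (X K T : FJ) (i : mor K T) (e : mor T X)
    (unit : forall j, mor (X j) (T j)) :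
    conflation i e -> @is_free_functor J F J id X T unit ->
    (forall j, (e : nattrans T X) j ∘ unit j = idm (X j)) ->
  zero_below k X -> zero_below k.+1 K.
Proof.
move=> conf freeT eP X0 j; rewrite ltnS => le_dj_k.
have kerj := conf_kernel exF (conf j).
have ue : unit j ∘ (e : nattrans T X) j = idm (T j).
  apply: (free_mor_ext freeT) => a g; rewrite comp1m.
  have [idg|nidg] := pselect (is_identity g).
    by case: idg => /=; rewrite fmor1 comp1m -compmA eP compm1.
  have X0a : idm (X a) = 0 by apply: X0; exact: leq_trans (dP nidg) le_dj_k.
  by rewrite (zero_mor_l (_ ∘ (_ ∘ _)) X0a) (zero_mor_l (_ ∘ _) X0a).
apply: (kernel_mono kerj).
by rewrite compm0 compm1 -[LHS]comp1m -ue -compmA (kernel_comp0 kerj) compm0.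
Qed.

Lemma gorenstein_projective_orth (X : FJ) :
  gorenstein_projective X -> orth_termwise_projective X.
Proof.
move=> gpX W projW.
(* [W'] vanishes in degrees below [k], and [c] bounds the number of degrees left. All syzygies are
   treated at once, because replacing [W'] by [K] raises [m] by one. *)
suff main c : forall k, (n < k + c)%N -> forall W', termwise_projective W' ->
    zero_below k W' -> forall m, ext_orth (iter m (syz syzFJ) X) W'.
  by apply: (main n.+1 0%N _ W projW _ 0%N).
elim: c => [|c IH] k lt_n_kc W' projW' W0 m.
  (* Here [k] exceeds [n], so [W'] is zero. *)
  move=> A B i p conf f; exists 0; rewrite comp0m.
  apply: nattransP => j; apply/esym/zero_mor_r/W0.
  by rewrite addn0 in lt_n_kc; exact: leq_trans (ltn_ord _) lt_n_kc.
have [K [T [i [e [unit [conf freeT eP split_i]]]]]] :=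
  free_resolution exF wicF finJ finhomJ W'.
have projT : projective T by exact: (free_projective freeT).
apply: (ext_orth_syzygy_shift syzFJ conf (syz_conf syzFJ _)).
- exact: cover_projective.
- apply: (IH k.+1 _ K _ _ m.+1); first by rewrite addSnnS.
    move=> j; have [r ri] := split_i j; apply: (projective_retract ri).
    exact: (free_termwise_projective freeT).
  exact: (resolution_zero_below conf freeT eP).
- by apply: ext_orth_of_vanishes => m'; exact: gpX.
Qed.

End Direct.

Lemma finite_direct_orth (X : FJ) :
  finite_direct J -> gorenstein_projective X -> orth_termwise_projective X.
Proof. by case=> _ [n [d dP]]; exact: (gorenstein_projective_orth dP). Qed.

(* Evaluation at j is left adjoint to the coinduction of objects of F to
   functors on J, which preserves injectives; so testing against the
   injectives of F is the same as testing against coinduced functors. *)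
Lemma coinduced (j : J) (Q : F) : injective_ob Q ->
  exists (W : FJ) (counit : mor (W j) Q),
    [/\ termwise_projective W,
        forall (Y : FJ) (f : mor (Y j) Q), exists g : mor Y W,
          counit ∘ (g : nattrans Y W) j = f &
        forall (Y : FJ) (g g' : mor Y W),
          counit ∘ (g : nattrans Y W) j = counit ∘ (g' : nattrans Y W) j ->
          g = g'].
Proof.
move=> injQ; have [W [counit cofreeW]] := cofree_functor_exists
  (fun=> j) (fun=> Q) (exact_additive exF) listable_unit finhomJ.
exists W, (counit tt); split.
- move=> i; apply: frobenius_inj_proj.
  exact: (cofree_termwise_injective cofreeW).
- move=> Y f; have [g gP] := cofree_nat cofreeW (fun=> f).
  by exists g; exact: gP.
- by move=> Y g g' eqg; apply: (cofree_nat_ext cofreeW) => -[].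
Qed.

End FrobeniusDiagrams.

(** * The left Kan extension *)

Section LeftKanExtension.
Variables (I J : category) (u : functor I J) (F : confcat).
Hypothesis frobF : is_frobenius F.
Hypothesis wicF : weakly_idempotent_complete F.
Hypothesis finI : listable I.
Hypothesis finhomI : forall i j : I, listable (mor i j).
Hypothesis finJ : listable J.
Hypothesis finhomJ : forall i j : J, listable (mor i j).
Local Notation FI := (functor_confcat I F).
Local Notation FJ := (functor_confcat J F).
Local Notation res := (restriction u F).

Let exF : is_exact F. Proof. by case: frobF. Qed.
Let enoughP : enough_projectives F. Proof. by case: frobF. Qed.
Let enoughI : enough_injectives F. Proof. by case: frobF. Qed.
Let syzFI : has_syzygies FI :=
  functor_has_syzygies exF wicF finI finhomI enoughP.
Let syzFJ : has_syzygies FJ :=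
  functor_has_syzygies exF wicF finJ finhomJ enoughP.

(** [R] represents Hom(G, res -). Stated one object at a time, this describes a partial left adjoint
    of [res]. *)
Definition universal_arrow (G : FI) (R : FJ) (eta : mor G (res R)) :=
  forall (Y : FJ) (f : mor G (res Y)),
  exists! g : mor R Y, fmor res g ∘ eta = f.

Lemma universal_desc (G : FI) (R : FJ) (eta : mor G (res R)) (Y : FJ)
    (f : mor G (res Y)) :
  universal_arrow eta -> exists g : mor R Y, fmor res g ∘ eta = f.
Proof. by move=> univ; have [g [gP _]] := univ Y f; exists g. Qed.

Lemma universal_ext (G : FI) (R : FJ) (eta : mor G (res R)) (Y : FJ)
    (g g' : mor R Y) :
  universal_arrow eta -> fmor res g ∘ eta = fmor res g' ∘ eta -> g = g'.
Proof.
move=> univ eqg; have [h [_ uniq_h]] := univ Y (fmor res g' ∘ eta).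
by rewrite -(uniq_h g eqg) -(uniq_h g').
Qed.

Lemma restriction0 (Y Z : FJ) : fmor res (0 : mor Y Z) = 0.
Proof. exact: nattransP. Qed.

Lemma restriction_termwise_projective (W : FJ) :
  termwise_projective W -> termwise_projective (res W).
Proof. by move=> projW i; exact: projW. Qed.

(** * Exactness of the partial left adjoint *)

Section UniversalExact.
Variables (G1 G2 G3 : FI) (R1 R2 R3 : FJ).
Variables (i : mor G1 G2) (p : mor G2 G3).
Variables (eta1 : mor G1 (res R1)) (eta2 : mor G2 (res R2)).
Variables (eta3 : mor G3 (res R3)).
Variables (i' : mor R1 R2) (p' : mor R2 R3).
Hypothesis univ1 : universal_arrow eta1.
Hypothesis univ2 : universal_arrow eta2.
Hypothesis univ3 : universal_arrow eta3.
Hypothesis sq_i : fmor res i' ∘ eta1 = eta2 ∘ i.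
Hypothesis sq_p : fmor res p' ∘ eta2 = eta3 ∘ p.
Hypothesis conf : conflation i p.
Hypothesis orth3 : orth_termwise_projective G3.

(** By adjunction the task is to extend a map into [res W] along [i], which the vanishing of
    Ext^1(G3, res W) allows. *)
Lemma universal_extend (W : FJ) (a : mor R1 W) :
  termwise_projective W -> exists b : mor R2 W, b ∘ i' = a.
Proof.
move=> projW.
have [b' b'i] := orth3 (restriction_termwise_projective projW) conf
  (fmor res a ∘ eta1).
have [b bP] := universal_desc b' univ2; exists b.
by apply: (universal_ext univ1); rewrite fmorM -compmA sq_i compmA bP.
Qed.

Lemma universal_extend_at (j : J) (Q : F) (a : mor (R1 j) Q) :
  injective_ob Q ->
  exists b : mor (R2 j) Q, b ∘ (i' : nattrans R1 R2) j = a.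
Proof.
move=> injQ.
have [W [counit [projW adj _]]] := coinduced frobF finhomJ j injQ.
have [g gP] := adj R1 a; have [b bi] := universal_extend g projW.
exists (counit ∘ (b : nattrans R2 W) j).
by rewrite -gP -compmA -nat_compE bi.
Qed.

(** Extending an embedding of [R1 j] into an injective along [i'] makes [i'] at [j] the first factor
    of an admissible monomorphism. *)
Lemma universal_admissible_mono : admissible_mono i'.
Proof.
apply: (functor_cokernel exF) => j.
have [Q [a [injQ ma]]] := enoughI (R1 j).
have [b bi] := universal_extend_at a injQ.
by apply: (admissible_mono_factor exF wicF (g := b)); rewrite bi.
Qed.

(** Each test against an injective at [j] is transposed to a coinduced functor on [J] and from there
    to [I], where [conf] and [orth3] answer it. *)
Lemma universal_conf : conflation i' p'.
Proof.
have cok := functor_conf_cokernel exF conf.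
have p'i' : p' ∘ i' = 0.
  apply: (universal_ext univ1); rewrite fmorM -compmA sq_i compmA sq_p -compmA.
  by rewrite (cokernel_comp0 cok) compm0 restriction0 comp0m.
move=> j; apply: (conflation_by_injectives exF wicF enoughI).
- by rewrite -nat_compE p'i'.
- by move=> Q injQ a; exact: universal_extend_at.
- move=> Q injQ b bi.
  have [W [counit [projW adj adj_ext]]] := coinduced frobF finhomJ j injQ.
  have [g gP] := adj R2 b.
  have gi : g ∘ i' = 0.
    by apply: adj_ext; rewrite /= compmA gP bi compm0.
  have [|c' c'p] := cokernel_desc (t := fmor res g ∘ eta2) cok.
    by rewrite -compmA -sq_i compmA -fmorM gi restriction0 comp0m.
  have [c cP] := universal_desc c' univ3.
  exists (counit ∘ (c : nattrans R3 W) j).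
  suff cp : c ∘ p' = g by rewrite -compmA -nat_compE cp.
  by apply: (universal_ext univ2); rewrite fmorM -compmA sq_p compmA cP.
- move=> Q injQ c c' eqc.
  have [W [counit [projW adj adj_ext]]] := coinduced frobF finhomJ j injQ.
  have [g gP] := adj R3 c; have [g' g'P] := adj R3 c'.
  rewrite -gP -g'P; congr (_ ∘ (_ : nattrans R3 W) j).
  have eqgp : g ∘ p' = g' ∘ p'.
    by apply: adj_ext; rewrite /= !compmA gP g'P.
  apply: (universal_ext univ3); apply: (cokernel_epi cok).
  by rewrite -!compmA -sq_p !compmA -!fmorM eqgp.
Qed.

End UniversalExact.

(** An extension of [R] by [W] restricts to one of [res R] by [res W]. Lifting [eta] through it and
    transposing yields a section. *)
Lemma universal_orth (G : FI) (R : FJ) (eta : mor G (res R)) :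
  universal_arrow eta -> orth_termwise_projective G ->
  orth_termwise_projective R.
Proof.
move=> univ orthG W projW; apply: (ext_orth_of_split syzFJ) => M i p conf.
have confres : conflation (fmor res i) (fmor res p) by move=> x; exact: conf.
have [l lP] := ext_orth_lift syzFI eta
  (orthG _ (restriction_termwise_projective projW)) confres.
have [s sP] := universal_desc l univ; exists s.
apply: (universal_ext univ).
by rewrite fmorM -compmA sP lP fmor1 comp1m.
Qed.

(** A left adjoint preserves cokernels, and [universal_admissible_mono] guarantees that the required
    cokernel exists. *)
Lemma universal_cokernel (K T G : FI) (k : mor K T) (e : mor T G)
    (RK RT : FJ) (etaK : mor K (res RK)) (etaT : mor T (res RT)) :
    conflation k e -> orth_termwise_projective G ->
    universal_arrow etaK -> universal_arrow etaT ->
  exists (R : FJ) (eta : mor G (res R)), universal_arrow eta.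
Proof.
move=> conf orthG univK univT.
have [k' sq_k] := universal_desc (etaT ∘ k) univK.
have [R [q confR]] := universal_admissible_mono univK univT sq_k conf orthG.
have cok := functor_conf_cokernel exF conf.
have cokR := functor_conf_cokernel exF confR.
have [|eta etae] := cokernel_desc (t := fmor res q ∘ etaT) cok.
  rewrite -compmA -sq_k compmA -fmorM (cokernel_comp0 cokR) restriction0.
  by rewrite comp0m.
have ext Y (h h' : mor R Y) :
    fmor res h ∘ eta = fmor res h' ∘ eta -> h = h'.
  move=> eqh; apply: (cokernel_epi cokR); apply: (universal_ext univT).
  by rewrite !fmorM -!compmA -etae !compmA eqh.
exists R, eta => Y f.
have [g gP] := universal_desc (f ∘ e) univT.
have [|h hq] := cokernel_desc (t := g) cokR.
  apply: (universal_ext univK); rewrite fmorM -compmA sq_k compmA gP -compmA.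
  by rewrite (cokernel_comp0 cok) compm0 restriction0 comp0m.
have hP : fmor res h ∘ eta = f.
  apply: (cokernel_epi cok).
  by rewrite -compmA etae compmA -fmorM hq gP.
by exists h; split=> // h' h'P; apply: ext; rewrite hP h'P.
Qed.

(** Maps from [T] to [res Y] and maps from the free functor on the [X i] at the objects [u i] to [Y]
    are both families of maps from [X i] to [Y (u i)]. *)
Lemma universal_free (X : I -> F) (T : FI) (unit : forall i, mor (X i) (T i)) :
  @is_free_functor I F I id X T unit ->
  exists (R : FJ) (eta : mor T (res R)), universal_arrow eta.
Proof.
move=> freeT.
have [R [unitR freeR]] :=
  free_functor_exists u X (exact_additive exF) finI finhomJ.
have [eta etaP] := @free_nat I F I id X T unit freeT (res R) unitR.
exists R, eta => Y f.
have [g gP] := free_nat freeR (fun i => (f : nattrans T (res Y)) i ∘ unit i).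
exists g; split=> [|g' g'P].
  by apply: (free_nat_ext freeT) => i; rewrite /= -compmA etaP gP.
apply: (free_nat_ext freeR) => i.
by rewrite gP -g'P -etaP /= -compmA.
Qed.

Lemma universal_arrow_exists (G : FI) :
  finite_direct I -> orth_termwise_projective G ->
  exists (R : FJ) (eta : mor G (res R)), universal_arrow eta.
Proof.
case=> _ [n [d dP]] orthG.
(* Again [c] bounds the number of degrees left. The kernel of the free resolution starts one degree
   higher and stays orthogonal, so [universal_cokernel] applies. *)
suff main c : forall k, (n < k + c)%N -> forall G', zero_below d k G' ->
    orth_termwise_projective G' ->
    exists (R : FJ) (eta : mor G' (res R)), universal_arrow eta.
  exact: (main n.+1 0%N _ G).
elim: c => [|c IH] k lt_n_kc G' G0 orthG'.
  have [[Z Z0] _] := exact_additive exF.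
  pose R : FJ := @Functor J F (fun=> Z) (fun _ _ _ => idm Z) (fun=> erefl)
    (fun _ _ _ _ _ => esym (comp1m (idm Z))).
  rewrite addn0 in lt_n_kc.
  exists R, 0 => Y f; exists 0; split=> [|g _].
    by rewrite compm0 (zero_above_mor f lt_n_kc G0).
  by apply: nattransP => j; apply/esym/zero_mor_l.
have [K [T [k' [e [unit [conf freeT eP _]]]]]] :=
  free_resolution exF wicF finI finhomI G'.
have [RT [etaT univT]] := universal_free freeT.
have orthK : orth_termwise_projective K.
  apply: (orth_kernel frobF wicF finI finhomI conf) => //.
  exact: (orth_free frobF wicF finI finhomI freeT).
have [||RK [etaK univK]] := IH k.+1 _ K _ orthK.
- by rewrite addSnnS.
- exact: (resolution_zero_below frobF dP conf freeT eP).
exact: (universal_cokernel conf orthG' univK univT).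
Qed.

End LeftKanExtension.

(** * The functor [u_!] and its adjunction *)

Theorem corollaryA26 (F : confcat)
    (hF : is_frobenius F) (hwic : weakly_idempotent_complete F)
    (I J : category) (hI : finite_direct I) (hJ : finite_direct J)
    (u : functor I J) :
  exists ushriek : functor (GProj (functor_confcat I F))
                           (GProj (functor_confcat J F)),
    is_exact_functor ushriek /\
    exists phi : forall (G : GProj (functor_confcat I F))
                        (Y : functor_confcat J F),
        {additive mor (sval G) (restriction u F Y) ->
                  mor (sval (ushriek G)) Y},
      (forall G Y, bijective (phi G Y)) /\
      (forall (G G' : GProj (functor_confcat I F))
              (Y Y' : functor_confcat J F)
              (a : mor G' G) (b : mor Y Y')
              (f : mor (sval G) (restriction u F Y)),
         phi G' Y' (fmor (restriction u F) b ∘ f ∘ a)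
         = b ∘ phi G Y f ∘ fmor ushriek a).
Proof.
have finI : listable I by apply: finite_set_listable; exact: hI.1.1.
have finJ : listable J by apply: finite_set_listable; exact: hJ.1.1.
have homI (i j : I) : listable (mor i j).
  by apply: finite_set_listable; exact: hI.1.2.
have homJ (i j : J) : listable (mor i j).
  by apply: finite_set_listable; exact: hJ.1.2.
pose res := restriction u F.
have orth (G : GProj (functor_confcat I F)) :
    orth_termwise_projective (sval G).
  exact: (finite_direct_orth hF hwic finI homI hI (svalP G)).
have exR G := universal_arrow_exists u hF hwic finI homI homJ hI (orth G).
pose R G := sval (cid (exR G)).
pose e1 G := cid (svalP (cid (exR G))).
pose eta G : mor (sval G) (res (R G)) := sval (e1 G).
have univ G : universal_arrow (eta G) := svalP (e1 G).
have gpR G : gorenstein_projective (R G).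
  apply: (gorenstein_projective_of_orth hF hwic finJ homJ).
  exact: (universal_orth hF hwic finI homI finJ homJ (univ G) (orth G)).
(* [adj] is the transposition. Each equation about it is checked after restricting and composing
   with [eta], by uniqueness. *)
pose adj G Y (f : mor (sval G) (res Y)) : mor (R G) Y :=
  sval (cid (universal_desc f (univ G))).
have adjP G Y f : fmor res (adj G Y f) ∘ eta G = f.
  exact: svalP (cid (universal_desc f (univ G))).
pose obS G : GProj (functor_confcat J F) := exist _ (R G) (gpR G).
pose morS G G' (a : mor G G') : mor (obS G) (obS G') :=
  adj G (R G') (eta G' ∘ a).
have morSP G G' (a : mor G G') : fmor res (morS G G' a) ∘ eta G = eta G' ∘ a.
  exact: adjP.
have morS1 G : morS G G (idm G) = idm (obS G).
  apply: (universal_ext (univ G)); rewrite morSP.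
  by rewrite (fmor1 res) comp1m compm1.
have morSM G G' G'' (b : mor G' G'') (a : mor G G') :
    morS G G'' (b ∘ a) = morS G' G'' b ∘ morS G G' a.
  apply: (universal_ext (univ G)); rewrite morSP.
  rewrite (fmorM res) -[RHS]compmA (morSP G G' a) [RHS]compmA.
  by rewrite (morSP G' G'' b) -[RHS]compmA.
pose S := Functor morS1 morSM.
have resD (Y Z : functor_confcat J F) (f g : mor Y Z) :
    fmor res (f + g) = fmor res f + fmor res g.
  exact: nattransP.
exists S; split; first split.
- move=> G G' f g; apply: (universal_ext (univ G)); rewrite morSP.
  by rewrite resD compDl !morSP compDr.
- move=> X Y Z i p conf.
  exact: (universal_conf hF hwic homJ (univ X) (univ Y) (univ Z)
    (morSP _ _ i) (morSP _ _ p) conf (orth Z)).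
have resB (Y Z : functor_confcat J F) (f g : mor Y Z) :
    fmor res (f - g) = fmor res f - fmor res g.
  exact: nattransP.
(* [adj G Y] inverts the additive map [fmor res g ∘ eta G] of [g]. Additivity is stated here through
   differences. *)
have adjB G Y : zmod_morphism (adj G Y).
  move=> f g; apply: (universal_ext (univ G)).
  by rewrite resB compBl !adjP.
pose phi G Y : {additive mor (sval G) (res Y) -> mor (sval (S G)) Y} :=
  HB.pack (adj G Y) (GRing.isZmodMorphism.Build _ _ (adj G Y) (adjB G Y)).
exists phi; split=> [G Y|G G' Y Y' a b f].
  exists (fun g => fmor res g ∘ eta G) => [f|g]; first exact: adjP.
  by apply: (universal_ext (univ G)); exact: adjP.
apply: (universal_ext (univ G')); rewrite adjP.
rewrite !(fmorM res) -(compmA _ _ (eta G')) morSP !compmA.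
by rewrite -(compmA _ _ (eta G)) adjP.
Qed.
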